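(* Let $\mathfrak{F}_{\mathrm{cap},1}(s,p)$ be the degree $1$ part of the descendant SFT-potential of the cap and let $\mathcal{F}_{\mathbb{P}^1,1}(s)$ be the degree $1$ part of the Gromov--Witten potential of $\mathbb{P}^1$ with descendants of the K\''ahler class. Then $$\mathfrak{F}_{\mathrm{cap},1}(s,p)=\frac{1}{\hbar}\exp\left(\sum_{n\ge0} s_{2,2n}\frac{\hbar^n}{2^{2n}(2n+1)!}\right)p_1,\qquad \mathcal{F}_{\mathbb{P}^1,1}(s)=\frac{1}{\hbar}\exp\left(\sum_{n\ge0} s_{2,2n}\frac{\hbar^n}{2^{2n}(2n+1)!}\right).$$
   Context: Gromov--Witten potential. Let $\omega\in H^2(\mathbb{P}^1)$ with $\int_{\mathbb{P}^1}\omega=1$ and let $$\langle\tau_{n_1}(\omega)\cdots\tau_{n_r}(\omega)\rangle^{\mathbb{P}^1}_{g,d}=\int_{[\overline{\mathcal{M}}_{g,r}(\mathbb{P}^1,d)]^{\mathrm{vir}}}\prod_{i=1}^r c_1(\psi_i)^{n_i}\,\mathrm{ev}_i^*(\omega)$$ (connected domains; $\psi_i$ is the cotangent line bundle at the $i$-th marked point). With formal variables $s=(s_{2,n})_{n\ge0}$ (the first index $2$ is only a label), $\hbar$ and $z$, $$\mathcal{F}_{\mathbb{P}^1}(s,z)=\sum_{g\ge0}\hbar^{g-1}\sum_{d\ge0}z^d\sum_{r\ge0}\frac1{r!}\sum_{n_1,\dots,n_r\ge0}s_{2,n_1}\cdots s_{2,n_r}\langle\tau_{n_1}(\omega)\cdots\tau_{n_r}(\omega)\rangle^{\mathbb{P}^1}_{g,d}=\sum_{i\ge0}\mathcal{F}_{\mathbb{P}^1,i}(s)z^i,$$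 unstable terms being zero. Cap potential. The cap is $W=\mathbb{C}$, regarded as a completed symplectic cobordism with a single positive cylindrical end over $S^1$; the periodic Reeb orbits are the $k$-fold covers $\gamma_k$ of $S^1$, $k\ge1$, with associated formal variables $p_k$. Let $\Theta$ be a compactly supported closed $2$-form on $W$ with integral $1$. Then $$\mathfrak{F}_{\mathrm{cap}}(s,p)=\sum_{g\ge0}\hbar^{g-1}\sum_{r,m\ge0}\frac{1}{r!\,m!}\sum_{n_1,\dots,n_r\ge0}\ \sum_{k_1,\dots,k_m\ge1}\Big(\prod_{i}s_{2,n_i}\Big)\Big(\prod_j\frac{p_{k_j}}{k_j}\Big)\langle\tau_{n_1}(\Theta),\dots,\tau_{n_r}(\Theta);\gamma_{k_1},\dots,\gamma_{k_m}\rangle_g ,$$ where the correlator is the integral of $\prod_i \mathrm{ev}_i^*\Theta\wedge c_1(\psi_i)^{n_i}$ over the (compactified, virtual) moduli space of connected genus $g$ holomorphic curves in $W$ with $r$ marked points and $m$ positive punctures, the $j$-th one asymptotic to $\gamma_{k_j}$. The degree decomposition is $\mathfrak{F}_{\mathrm{cap}}(s,p)|_{p_k\mapsto z^kp_k}=\sum_{i\ge0}\mathfrak{F}_{\mathrm{cap},i}(s,p)z^i$. Standing facts from Symplectic Field Theory assumed throughout the paper. Put $\mathcal{S}(t)=\frac{\sinh(t/2)}{t/2}$ and $u(x)=\sum_{k\ge1}(p_ke^{ikx}+q_ke^{-ikx})$, let $\int_{S^1}dx$ be normalized to total mass $1$, and define $$\mathcal{H}(z)=\frac{1}{\mathcal{S}(\sqrt\hbar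 z)}:\int_{S^1}e^{z\,\mathcal{S}(i\sqrt\hbar z\partial_x)u(x)}\,dx:\,,\qquad \mathbf{H}_{n}=\frac1\hbar\frac{1}{(n+2)!}\frac{\partial^{n+2}\mathcal{H}(z)}{\partial z^{n+2}}\Big|_{z=0}\quad(n\ge0).$$ Let $\overleftarrow{\mathbf{H}_n}$ be the operator on functions of $p=(p_1,p_2,\dots)$ obtained by replacing $q_k$ by $k\hbar\,\partial/\partial p_k$, where in each (normally ordered) monomial all derivatives are applied to the function first and the multiplications by the $p_k$ are performed afterwards. These operators commute. Then: (i) $\mathfrak{F}_{\mathrm{cap}}(0,p)=p_1/\hbar$, and $e^{\mathfrak{F}_{\mathrm{cap}}(s,p)}$ is the result of applying $\prod_{n\ge0}e^{s_{2,n}\overleftarrow{\mathbf{H}_n}}$ to $e^{\mathfrak{F}_{\mathrm{cap}}(0,p)}$; (ii) $e^{\mathcal{F}_{\mathbb{P}^1}(s,z)}=\left.\left(e^{\overrightarrow{\mathfrak{F}}_{\mathrm{cap}}(s)}\,e^{q_1/\hbar}\right)\right|_{q=0}$, where $\overrightarrow{\mathfrak{F}}_{\mathrm{cap}}(s)$ is obtained from $\mathfrak{F}_{\mathrm{cap}}(s,p)$ by replacing $p_k$ with $\hbar k z^k\,\partial/\partial q_k$. *)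

(* Defs.v *)
From HB Require Import structures.
From mathcomp Require Import all_boot all_order all_algebra finmap.
From mathcomp Require Import boolp classical_sets functions cardinality fsbigop.
From mathcomp Require Import fraction monalg.

Set Implicit Arguments.
Unset Strict Implicit.
Unset Printing Implicit Defensive.

Import Order.TTheory GRing.Theory Num.Theory.
Local Open Scope ring_scope.

(* [vs n], [vp k], [vq k], [vz] are the variables s_{2,n}, p_k, q_k, z.  Only
   indices k >= 1 of p_k and q_k are used. *)
Inductive var := vs of nat | vp of nat | vq of nat | vz.

Definition var_code (v : var) : nat * nat :=
  match v with vs n => (0, n) | vp k => (1, k) | vq k => (2, k) | vz => (3, 0) end%N.
Definition var_decode (c : nat * nat) : option var :=
  match c with
  | (0, n) => Some (vs n) | (1, k) => Some (vp k) | (2, k) => Some (vq k)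
  | _ => Some vz
  end%N.
Lemma var_codeK : pcancel var_code var_decode. Proof. by case. Qed.
HB.instance Definition _ := Choice.copy var (pcan_type var_codeK).

Notation mono := {cmonom var}.

Lemma monoP (m1 m2 : mono) : (forall v, m1 v = m2 v) -> m1 = m2.
Proof. by move=> e; apply/eqP/cmP. Qed.

Lemma finite_divisors (m : mono) : finite_set [set a | exists b, mmul a b = m]%classic.
Proof.
pose T := {ffun finsupp m -> 'I_(mdeg m).+1}.
pose h (t : T) : mono :=
  [cmonom (if insub v is Some w then t w : nat else 0%N) | v in finsupp m]%M.
apply: (@sub_finite_set _ _ (h @` [set: T])%classic); last exact/finite_image/finite_finset.
move=> a [b abm].
have le v : (a v <= m v)%N by rewrite -abm cmM leq_addr.
have led v : (m v <= mdeg m)%N.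
  case: (mdomP m v) => // vm; rewrite mdegE (big_fsetD1 v) //= leq_addr //.
exists [ffun w : finsupp m => inord (a (val w))] => //.
apply: monoP => v; rewrite /h cmE fsfunE; case: ifPn => vm.
  by rewrite insubT ffunE /= inordK // ltnS (leq_trans (le v)).
by apply/esym/eqP; rewrite -leqn0 (leq_trans (le v)) // leqn0 cmE_eq0.
Qed.

Section FormalSeries.
Variable K : comNzRingType.

(* Formal power series in the variables [var], as coefficient functions. *)
Definition fps := mono -> K.
HB.instance Definition _ := GRing.Lmodule.copy fps (mono -> K^o).
Implicit Types f g h : fps.

Definition fps_one : fps := fun m => (m == mone)%:R.
(* A finite sum, by [finite_divisors]. *)
Definition fps_mul f g : fps := fun m =>
  \sum_(ab \in [set ab : mono * mono | mmul ab.1 ab.2 = m]%classic) f ab.1 * g ab.2.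

Let dvs (m : mono) : seq mono := fset_set [set a | exists b, mmul a b = m]%classic.

Let mem_dvs m a : reflect (exists b, mmul a b = m) (a \in dvs m).
Proof.
rewrite /dvs in_fset_set; last exact: finite_divisors.
by apply: (iffP idP) => [/set_mem|/mem_set].
Qed.

Let dvsM m a b : mmul a b \in dvs m -> (a \in dvs m) && (b \in dvs m).
Proof.
case/mem_dvs => c <-; apply/andP; split; apply/mem_dvs.
  by exists (mmul b c); rewrite mulmA.
by exists (mmul a c); rewrite mulmA (mulmC b).
Qed.

Let dvs_refl m : m \in dvs m.
Proof. by apply/mem_dvs; exists mone; rewrite mulm1. Qed.

Let mulE m n f g : n \in dvs m ->
  fps_mul f g n =
  \sum_(a <- dvs m) \sum_(b <- dvs m) if mmul a b == n then f a * g b else 0.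
Proof.
move=> nm; rewrite /fps_mul.
have -> : [set ab : mono * mono | mmul ab.1 ab.2 = n]%classic =
          [set` [pred ab : mono * mono | mmul ab.1 ab.2 == n]]%classic.
  by apply/seteqP; split=> ab /= /eqP.
rewrite -(@bigfs _ _ _ _ [seq (a, b) | a <- dvs m, b <- dvs m]).
- by rewrite big_mkcond big_allpairs.
- by rewrite allpairs_uniq ?fset_uniq // => -[? ?] [? ?].
- move=> [a b] /= /eqP abn /negP[]; move: nm; rewrite -abn => /dvsM/andP[am bm].
  by apply/allpairsP; exists (a, b).
Qed.

Fact fps_mulC : commutative fps_mul.
Proof.
move=> f g; apply/funext => m; rewrite !(mulE _ _ (dvs_refl m)) exchange_big /=.
by apply: eq_bigr => a _; apply: eq_bigr => b _; rewrite mulmC mulrC.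
Qed.

Fact fps_mulA : associative fps_mul.
Proof.
have key f g h m : fps_mul f (fps_mul g h) m =
    \sum_(a <- dvs m) \sum_(b <- dvs m) \sum_(c <- dvs m)
      if mmul a (mmul b c) == m then f a * (g b * h c) else 0.
  rewrite (mulE _ _ (dvs_refl m)); apply: eq_big_seq => a am.
  transitivity (\sum_(n <- dvs m) \sum_(b <- dvs m) \sum_(c <- dvs m)
     if (mmul b c == n) && (mmul a n == m) then f a * (g b * h c) else 0).
    apply: eq_big_seq => n nm; case: ifP => anm; last first.
      by rewrite big1 // => b _; rewrite big1 // => c _; rewrite andbF.
    rewrite (mulE _ _ nm) mulr_sumr; apply: eq_bigr => b _.
    rewrite mulr_sumr; apply: eq_bigr => c _; rewrite andbT.
    by case: ifP; rewrite ?mulr0.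
  rewrite exchange_big /=; apply: eq_bigr => b _.
  rewrite exchange_big /=; apply: eq_bigr => c _.
  have [abcm|abcm] := eqVneq (mmul a (mmul b c)) m.
    have bcm : mmul b c \in dvs m.
      by apply/mem_dvs; exists a; rewrite mulmC.
    rewrite (bigD1_seq _ bcm) ?fset_uniq //= eqxx abcm eqxx /= big1 ?addr0 //.
    by move=> n; rewrite eq_sym => /negPf->.
  rewrite big1 // => n _; case: ifP => // /andP[/eqP<-].
  by rewrite (negPf abcm).
move=> f g h; apply/funext => m; rewrite (fps_mulC (fps_mul f g)) !key.
rewrite [RHS]exchange_big /=; apply: eq_bigr => a _.
rewrite [RHS]exchange_big /=; apply: eq_bigr => b _; apply: eq_bigr => c _.
by rewrite (mulmC c) -mulmA (mulrC (h c)) -mulrA.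
Qed.

Fact fps_mul1 : left_id fps_one fps_mul.
Proof.
move=> f; apply/funext => m; rewrite (mulE _ _ (dvs_refl m)).
have m1 : mone \in dvs m by apply/mem_dvs; exists m; rewrite mul1m.
rewrite (bigD1_seq _ m1) ?fset_uniq //= [X in _ + X]big1 ?addr0; last first.
  move=> a /negPf a1; rewrite big1 // => b _.
  by rewrite /fps_one a1 mul0r if_same.
rewrite (bigD1_seq m) ?fset_uniq //= big1 ?addr0; last first.
  by move=> b /negPf bm; rewrite mul1m bm.
by rewrite mul1m eqxx /fps_one eqxx mul1r.
Qed.

Fact fps_mulDl : left_distributive fps_mul +%R.
Proof.
move=> f g h; apply/funext => m.
have addE (f1 f2 : fps) n : (f1 + f2) n = f1 n + f2 n by [].
rewrite addE !(mulE _ _ (dvs_refl m)) -big_split; apply: eq_bigr => a _ /=.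
rewrite -big_split; apply: eq_bigr => b _ /=.
by rewrite addE mulrDl; case: ifP; rewrite ?addr0.
Qed.

Fact fps_one_neq0 : fps_one != 0.
Proof.
by apply/eqP => /(congr1 (@^~ mone)) /eqP; rewrite /fps_one eqxx oner_eq0.
Qed.

HB.instance Definition _ := GRing.Zmodule_isComNzRing.Build fps
  fps_mulA fps_mulC fps_mul1 fps_mulDl fps_one_neq0.

Definition fX (v : var) : fps := fun m => (m == ucm v)%:R.

(* Sum of a family of series over the index set [D], coefficient by coefficient.
   It is meaningful when every monomial occurs in finitely many members of the
   family; a coefficient to which infinitely many members contribute gets the
   default value 0 of [\sum_(i \in D)]. *)
Definition fsum (I : choiceType) (D : set I) (F : I -> fps) : fps :=
  fun m => \sum_(i \in D) F i m.

Definition fderiv (v : var) f : fps := fun m => (m v).+1%:R * f (mmul (ucm v) m).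

Definition fsubst (sigma : var -> fps) f : fps :=
  fsum setT (fun m : mono => f m *: \prod_(v <- finsupp m) sigma v ^+ m v).

(* Multiplicative inverse of a series with constant term 1. *)
Definition finv f : fps := fsum setT (fun k : nat => (1 - f) ^+ k).

(* The composite of the operators [T v ^ (m v)], for a monomial [m]; it is only
   used for operators [T v] that commute with each other. *)
Definition opmono (T : var -> fps -> fps) (m : mono) f : fps :=
  foldr (fun v g => iter (m v) (T v) g) f (finsupp m).

End FormalSeries.

Section FieldCoefficients.
Variable K : fieldType.
Implicit Types f g F : fps K.

Definition fexp f : fps K := fsum setT (fun k : nat => (k`!%:R)^-1 *: f ^+ k).

Definition opexp (T : fps K -> fps K) f : fps K :=
  fsum setT (fun k : nat => (k`!%:R)^-1 *: iter k T f).

Definition coefz (i : nat) f : fps K :=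
  (i`!%:R)^-1 *: fsubst (fun v => if v is vz then 0 else fX K v) (iter i (fderiv vz) f).

Definition at_s0 f : fps K := fsubst (fun v => if v is vs _ then 0 else fX K v) f.
Definition at_q0 f : fps K := fsubst (fun v => if v is vq _ then 0 else fX K v) f.

Definition pdegree_part (i : nat) f : fps K :=
  coefz i (fsubst (fun v => if v is vp k then fX K vz ^+ k * fX K v else fX K v) f).

End FieldCoefficients.

(* Coefficients are taken in the field R(hbar).  In all the series below each
   coefficient is a Laurent polynomial in hbar: in the potentials, the dimension
   of the moduli space leaves at most one genus for a given monomial. *)
Notation Khbar R := {fraction {poly R}}.

Section Potentials.
Variable R : numFieldType.
Local Notation K := (Khbar R).
Local Notation fps := (fps K).

Definition hbar : K := tofrac 'X.
Definition cst (c : R) : K := tofrac c%:P.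

Definition s_ (n : nat) : fps := fX K (vs n).
Definition p_ (k : nat) : fps := fX K (vp k).
Definition q_ (k : nat) : fps := fX K (vq k).
Definition z_ : fps := fX K vz.

(* S(t) = sinh(t/2)/(t/2) = \sum_j Scoef j * t^(2j); as S is even, no square root
   of hbar is needed. *)
Definition Scoef (j : nat) : K := ((4 ^ j * (j.*2.+1)`!)%:R)^-1.

(* S(sqrt(hbar) z) *)
Definition S_hbar_z : fps :=
  fsum setT (fun j : nat => (Scoef j * hbar ^+ j) *: z_ ^+ j.*2).

(* The exponential e^{ikx} attached to p_k, and e^{-ikx} attached to q_k, are left
   implicit: a monomial [m] stands for [m] times e^{i (xfreq m) x}. *)
Definition xfreq (m : mono) : int :=
  \sum_(v <- finsupp m)
    (match v with vp k => k%:Z | vq k => - k%:Z | _ => 0 end) * (m v)%:Z.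

(* the operator i d/dx *)
Definition i_ddx (f : fps) : fps := fun m => - (xfreq m)%:~R * f m.

(* the mean over the circle *)
Definition xmean (f : fps) : fps := fun m => if xfreq m == 0 then f m else 0.

Definition u_field : fps := fsum [set k : nat | (0 < k)%N]%classic (fun k => p_ k + q_ k).

(* S(i sqrt(hbar) z d/dx) *)
Definition S_ddx (f : fps) : fps :=
  fsum setT (fun j : nat => (Scoef j * hbar ^+ j) *: (z_ ^+ j.*2 * iter j.*2 i_ddx f)).

(* Normally ordered symbols: p_k and q_k commute here. *)
Definition Hgen : fps := finv S_hbar_z * xmean (fexp (z_ * S_ddx u_field)).
Definition Hsym (n : nat) : fps := hbar^-1 *: coefz n.+2 Hgen.

(* q_k is replaced by k hbar d/dp_k, and the derivatives are applied first. *)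
Definition left_op (F f : fps) : fps :=
  fsum setT (fun m : mono => F m *:
    opmono (fun v => if v is vp k then *%R (p_ k) else id) m
      (opmono (fun v => if v is vq k then fun g => (k%:R * hbar) *: fderiv (vp k) g
                        else id) m f)).

(* p_k is replaced by hbar k z^k d/dq_k. *)
Definition right_op (F f : fps) : fps :=
  fsum setT (fun m : mono => F m *:
    opmono (fun v => if v is vp k
                     then fun g => (hbar * k%:R) *: (z_ ^+ k * fderiv (vq k) g)
                     else *%R (fX K v)) m f).

(* [cap g ns ks] stands for
   < tau_{n_1}(Theta), ..., tau_{n_r}(Theta); gamma_{k_1}, ..., gamma_{k_m} >_g,
   where ns = [n_1; ...; n_r] and ks = [k_1; ...; k_m]. *)
Definition cap_potential (cap : nat -> seq nat -> seq nat -> R) : fps :=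
  fsum [set i : nat * seq nat * seq nat | all (leq 1) i.2]%classic
    (fun '(g, ns, ks) =>
       (hbar ^+ g / hbar * (((size ns)`! * (size ks)`!)%:R)^-1 * cst (cap g ns ks)) *:
       (\prod_(n <- ns) s_ n * \prod_(k <- ks) (k%:R^-1 *: p_ k))).

(* Domains of degree d, genus g and r marked points are stable unless d = 0 and
   2g - 2 + r <= 0. *)
Definition stable (g d r : nat) : bool := (0 < d)%N || (2 < g.*2 + r)%N.

(* [gw g d ns] stands for < tau_{n_1}(omega) ... tau_{n_r}(omega) >_{g,d}. *)
Definition P1_potential (gw : nat -> nat -> seq nat -> R) : fps :=
  fsum [set i : nat * nat * seq nat | let: (g, d, ns) := i in stable g d (size ns)]%classic
    (fun '(g, d, ns) =>
       (hbar ^+ g / hbar * ((size ns)`!%:R)^-1 * cst (gw g d ns)) *: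
       (z_ ^+ d * \prod_(n <- ns) s_ n)).

(* \prod_(n >= 0) T_n applied to [f] equals [g]: each coefficient of the finite
   products is eventually that of [g]. *)
Definition op_prod_eq (T : nat -> fps -> fps) (f g : fps) : Prop :=
  forall m, exists N0, forall N, (N0 <= N)%N -> foldr T f (iota 0 N) m = g m.

End Potentials.

(* Main.v *)
(* Terms of frequency 0 without p contain no q either.  Hence H_n acts on the part of a
   series of p-degree 0 by a constant c_n, and on the part of degree 1 by c_n + a_n, where a_n
   is hbar times the coefficient of p_1 q_1 in H_n.  In H(z) that monomial has coefficient
   (1 / S) * (z S)^2 = z^2 S with S = S(sqrt(hbar) z), so a_n is the coefficient of z^n in S.
   Applying the product of the exp(s_n H_n) to exp(p_1 / hbar) thus gives exp(sum c_n s_n) in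
   degree 0 and (p_1 / hbar) exp(sum (c_n + a_n) s_n) in degree 1; since
   e^F = e^(F_0) (1 + F_1 + ...), this determines F_1.  On the P^1 side only the terms of F of
   p-degree at most 1 act modulo z^2, and there the operator is F_0 + F_1 hbar z d/dq_1. *)

Require Import Defs.
From HB Require Import structures.
From mathcomp Require Import all_boot all_order all_algebra finmap.
From mathcomp Require Import boolp classical_sets functions cardinality fsbigop.
From mathcomp Require Import fraction monalg.
From mathcomp Require Import zify.
Import Order.TTheory GRing.Theory Num.Theory.
Local Open Scope ring_scope.
Set Implicit Arguments.
Unset Strict Implicit.
Unset Printing Implicit Defensive.

(** * Formal power series *)

Lemma mmulI (a b c : mono) : mmul a b = mmul a c -> b = c.
Proof.
move=> e; apply: monoP => v; move/(congr1 (fun m : mono => m v)): e.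
by rewrite !cmM => /addnI.
Qed.

Lemma mmul_divcm (a m : mono) : (forall v, a v <= m v)%N -> mmul a (divcm m a) = m.
Proof. by move=> le; apply: monoP => v; rewrite cmM divcmE subnKC. Qed.

Lemma mmul_ucm v (m : mono) : m v != 0%N -> mmul (ucm v) (divcm m (ucm v)) = m.
Proof.
move=> mv; apply: mmul_divcm => w; rewrite cmU.
by case: eqVneq => // <-; rewrite lt0n.
Qed.

Definition mpow (n : nat) (a : mono) : mono := iter n (mmul a) mone.

Lemma mpowE n (a : mono) v : mpow n a v = (n * a v)%N.
Proof. by elim: n => [|n IH] /=; rewrite ?cm1 // cmM IH mulSn. Qed.

Definition face (A : pred var) (m : mono) : bool := all A (finsupp m).

Lemma faceP (A : pred var) (m : mono) :
  reflect (forall v, ~~ A v -> m v = 0%N) (face A m).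
Proof.
apply: (iffP allP) => [Am v nA|Am v].
  by apply/eqP; rewrite cmE_eq0; apply: contra nA => /Am.
by rewrite -cmE_neq0; apply: contraR => /Am ->.
Qed.

Lemma faceM A (a b : mono) : face A (mmul a b) = face A a && face A b.
Proof.
apply/faceP/andP => [h|[/faceP ha /faceP hb] v /[dup] /ha av /hb bv].
  by split; apply/faceP => v /h /eqP; rewrite cmM addn_eq0 => /andP[/eqP ? /eqP].
by rewrite cmM av bv.
Qed.

Lemma face1 A : face A mone. Proof. by rewrite /face mdom1. Qed.

Lemma faceU A v : face A (ucm v) = A v.
Proof. by rewrite /face mdomU; apply/allP/idP => [->|Av w]; rewrite ?inE // => /eqP->. Qed.

Lemma face_mpow (A : pred var) n v : A v -> face A (mpow n (ucm v)).
Proof.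
move=> Av; apply/faceP => w; rewrite mpowE cmU.
by have [<-|] := eqVneq v w; rewrite ?Av ?muln0.
Qed.

(* Locked, since the unifier otherwise unfolds distinct variables without bound. *)
HB.lock Definition fmon (K : fieldType) (a : mono) : fps K := fun m => (m == a)%:R.
Canonical fmon_unlockable := Unlockable fmon.unlock.
Notation fvar K v := (fmon K (ucm v)).

Section Series.
Variable K : fieldType.
Local Notation fmon := (fmon K).
Local Notation fvar v := (fmon (ucm v)).
Implicit Types (f g h : fps K) (m a b : mono) (A : pred var).

Lemma fpsDE f g m : (f + g) m = f m + g m. Proof. by []. Qed.
Lemma fpsNE f m : (- f) m = - f m. Proof. by []. Qed.
Lemma fpsZE c f m : (c *: f) m = c * f m. Proof. by []. Qed.
Lemma fps1E m : (1 : fps K) m = (m == mone)%:R. Proof. by []. Qed.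
Lemma fpsME f g m :
  (f * g) m = \sum_(ab \in [set ab : mono * mono | mmul ab.1 ab.2 = m]%classic) f ab.1 * g ab.2.
Proof. by []. Qed.

Lemma fps_sumE (I : Type) (r : seq I) (P : pred I) (F : I -> fps K) m :
  (\sum_(i <- r | P i) F i) m = \sum_(i <- r | P i) F i m.
Proof. exact: (big_morph (fun f : fps K => f m)). Qed.

Lemma finite_factorizations m :
  finite_set [set ab : mono * mono | mmul ab.1 ab.2 = m]%classic.
Proof.
apply: (@sub_finite_set _ _ ([set a | exists b, mmul a b = m] `*`
                             [set a | exists b, mmul a b = m])%classic).
  move=> [a b] /= abm; split => /=; first by exists b.
  by exists a; rewrite mulmC.
by apply: finite_setX; apply: finite_divisors.
Qed.

Definition eq_below m f g := forall a b, mmul a b = m -> f a = g a.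

Lemma eq_below_at m f g : eq_below m f g -> f m = g m.
Proof. by move/(_ m mone); apply; rewrite mulm1. Qed.

Lemma eq_fpsM m f f' g g' :
  (forall a b, mmul a b = m -> f a * g b = f' a * g' b) -> (f * g) m = (f' * g') m.
Proof. by move=> e; rewrite !fpsME; apply: eq_fsbigr => -[a b] /set_mem /= h; exact: e. Qed.

Lemma eq_belowM m f f' g g' :
  eq_below m f f' -> eq_below m g g' -> eq_below m (f * g) (f' * g').
Proof.
move=> ef eg a b abm; apply: eq_fpsM => c d cda; congr (_ * _).
  by apply: (ef _ (mmul d b)); rewrite mulmA cda.
by apply: (eg _ (mmul c b)); rewrite mulmA (mulmC d) cda.
Qed.

Lemma eq_belowX m f g k : eq_below m f g -> eq_below m (f ^+ k) (g ^+ k).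
Proof. by move=> e; elim: k => // k IH; rewrite !exprS; apply: eq_belowM. Qed.

Lemma fpsM1E f g : (f * g) mone = f mone * g mone.
Proof.
rewrite fpsME; set D := [set _ | _]%classic.
have -> : D = [set (mone, mone)]%classic; last by rewrite fsbig_set1.
apply/seteqP; split => [[a b]|_ ->]; rewrite /D /=; last by rewrite mulm1.
by move/unitm => [-> ->].
Qed.

Lemma fpsX1E f k : (f ^+ k) mone = f mone ^+ k.
Proof. by elim: k => [|k IH]; rewrite ?expr0 ?fps1E ?eqxx // !exprS fpsM1E IH. Qed.

Fact fps_scalerAl (c : K) f g : c *: (f * g) = c *: f * g.
Proof.
apply/funext => m; rewrite fpsZE !fpsME mulr_fsumr; apply: eq_fsbigr => -[a b] _ /=.
by rewrite fpsZE mulrA.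
Qed.
HB.instance Definition _ := GRing.Lmodule_isLalgebra.Build K (fps K) fps_scalerAl.
Fact fps_scalerAr (c : K) f g : c *: (f * g) = f * (c *: g).
Proof. by rewrite mulrC fps_scalerAl mulrC. Qed.
HB.instance Definition _ := GRing.Lalgebra_isAlgebra.Build K (fps K) fps_scalerAr.

Lemma fmonE a m : fmon a m = (m == a)%:R. Proof. by rewrite unlock. Qed.

Lemma fmonM a f m : (fmon a * f) (mmul a m) = f m.
Proof.
rewrite fpsME -(@fsbig_widen _ _ _ _ [set (a, m)]%classic) => [||[b c] /= [e ne]].
- by rewrite fsbig_set1 /= fmonE eqxx mul1r.
- by move=> _ ->.
- rewrite fmonE; case: eqVneq => [eb|]; last by rewrite mul0r.
  by case: ne; rewrite eb in e *; rewrite (mmulI e).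
Qed.

Lemma fmonM0 a f m : (exists v, m v < a v)%N -> (fmon a * f) m = 0.
Proof.
move=> [v av]; rewrite fpsME fsbig1 // => -[b c] /= e.
rewrite fmonE; case: eqVneq => [eb|]; last by rewrite mul0r.
by move: av; rewrite -e eb cmM ltnNge leq_addr.
Qed.

Lemma fmon_mul a b : fmon (mmul a b) = fmon a * fmon b.
Proof.
apply/funext => m; have [le|/existsNP [v /negP]] := pselect (forall v, a v <= m v)%N.
  rewrite -(mmul_divcm le) fmonM !fmonE; congr (nat_of_bool _)%:R.
  by apply/eqP/eqP => [/mmulI|->].
rewrite -ltnNge => lt; rewrite fmonM0; last by exists v.
rewrite fmonE; case: eqVneq => // e; move: lt.
by rewrite e cmM ltnNge leq_addr.
Qed.

Lemma fmon1 : fmon mone = 1. Proof. by rewrite unlock. Qed.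
Lemma fXE v : fX K v = fvar v. Proof. by rewrite unlock. Qed.

Lemma fmonX a k : fmon a ^+ k = fmon (mpow k a).
Proof. by elim: k => [|k IH]; rewrite ?expr0 ?fmon1 // exprS IH -fmon_mul. Qed.

Definition proj A f : fps K := fun m => if face A m then f m else 0.

Lemma projE A f m : face A m -> proj A f m = f m.
Proof. by rewrite /proj => ->. Qed.

Fact proj_is_linear A : linear (proj A).
Proof.
move=> c f g; apply/funext => m; rewrite /proj !(fpsDE, fpsZE).
by case: ifP => _; rewrite ?mulr0 ?addr0.
Qed.
HB.instance Definition _ A := GRing.isLinear.Build K (fps K) (fps K) _ (proj A) (proj_is_linear A).

Fact proj_is_monoid_morphism A : monoid_morphism (proj A).
Proof.
split=> [|f g]; apply/funext => m; rewrite /proj.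
  by rewrite fps1E; case: eqVneq => [->|_]; rewrite ?face1 // if_same.
case: ifP => [fm|/negP fm].
  apply: eq_fpsM => a b e; move: fm.
  by rewrite -e faceM => /andP[-> ->].
rewrite fpsME fsbig1 // => -[a b] /= e; move/negP: fm; rewrite -e faceM.
by case: (face A a); case: (face A b); rewrite //= ?mul0r ?mulr0.
Qed.
HB.instance Definition _ A :=
  GRing.isMonoidMorphism.Build (fps K) (fps K) (proj A) (proj_is_monoid_morphism A).

Lemma proj_fmon A a : proj A (fmon a) = if face A a then fmon a else 0.
Proof.
apply/funext => m; rewrite /proj !fmonE; case: eqVneq => [->|ne].
  by case: ifP => _; rewrite // fmonE eqxx.
by rewrite if_same; case: ifP; rewrite // fmonE (negPf ne).
Qed.

Lemma proj_fvar A v : proj A (fvar v) = if A v then fvar v else 0.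
Proof. by rewrite proj_fmon faceU. Qed.

Fact fderiv_is_linear v : linear (@fderiv K v).
Proof.
move=> c f g; apply/funext => m; rewrite /fderiv !(fpsDE, fpsZE).
by rewrite mulrDr mulrCA.
Qed.
HB.instance Definition _ v :=
  GRing.isLinear.Build K (fps K) (fps K) _ (@fderiv K v) (fderiv_is_linear v).

Lemma fvar_fderiv v f m : (fvar v * fderiv v f) m = (m v)%:R * f m.
Proof.
have [mv|mv] := eqVneq (m v) 0%N.
  by rewrite fmonM0 ?mv ?mul0r //; exists v; rewrite mv cmUU.
by rewrite -(mmul_ucm mv) fmonM /fderiv cmM cmUU add1n.
Qed.

Lemma fderivM v f g : fderiv v (f * g) = fderiv v f * g + f * fderiv v g.
Proof.
apply/funext => m; rewrite -(fmonM (ucm v) (_ + _)) mulrDr mulrA (mulrCA (fvar v)).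
rewrite fpsDE {1}/fderiv.
have -> : (m v).+1 = mmul (ucm v) m v by rewrite cmM cmUU add1n.
set M := mmul _ _; rewrite !fpsME mulr_fsumr.
rewrite -fsbig_split; last exact: finite_factorizations.
apply: eq_fsbigr => -[a b] /set_mem /= e.
rewrite !fvar_fderiv -e cmM natrD mulrDl.
congr (_ + _); first exact: mulrA.
exact: mulrCA.
Qed.

Lemma fderivX v f k : fderiv v (f ^+ k) = k%:R *: (f ^+ k.-1 * fderiv v f).
Proof.
elim: k => [|[|k] IH].
- rewrite expr0 scale0r; apply/funext => m; rewrite /fderiv fps1E.
  case: eqVneq => [e|]; last by rewrite mulr0.
  by move/(congr1 (fun m : mono => m v)): e; rewrite cmM cmUU cm1.
- by rewrite expr1 expr0 mul1r scale1r.
- rewrite exprS fderivM IH /= -scalerAr mulrA -exprS.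
  by rewrite -[in RHS]natr1 scalerDl scale1r addrC mulrC.
Qed.

Lemma fderiv_fvar v w : fderiv v (fvar w) = (v == w)%:R.
Proof.
apply/funext => m; rewrite /fderiv fmonE.
have [<-|ne] := eqVneq v w.
  have -> : (mmul (ucm v) m == ucm v) = (m == mone).
    by rewrite -{2}(mulm1 (ucm v)); apply/eqP/eqP => [/mmulI|->].
  by rewrite mulr1n fps1E; case: eqVneq => [->|]; rewrite ?mulr0 ?cm1 ?mulr1.
case: eqVneq => [/(congr1 (fun m : mono => m v))|]; last by rewrite mulr0.
by rewrite cmM cmUU cmU eq_sym (negPf ne).
Qed.

Section Fsum.
Variables (I : choiceType) (D : set I).
Implicit Types F G : I -> fps K.

Lemma fsumE F m (r : seq I) : uniq r -> (forall i, i \in r -> D i) ->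
  (forall i, D i -> i \notin r -> F i m = 0) -> fsum D F m = \sum_(i <- r) F i m.
Proof.
move=> ur rD out; rewrite /fsum (fsbigE r) //.
by rewrite big_seq_cond [RHS]big_seq; apply: eq_bigl => i;
   case: (boolP (i \in r)) => //= /rD Di; rewrite mem_set.
Qed.

Lemma fsum_single F m i0 : D i0 -> (forall i, D i -> i != i0 -> F i m = 0) ->
  fsum D F m = F i0 m.
Proof.
move=> Di0 out; rewrite (@fsumE _ _ [:: i0]) ?big_seq1 // => i; rewrite inE.
  by move/eqP->.
by move=> Di; apply: out.
Qed.

Lemma fsum_eq0 F m : (forall i, D i -> F i m = 0) -> fsum D F m = 0.
Proof. by move=> F0; rewrite /fsum fsbig1. Qed.

Lemma eq_fsum F G : (forall i, D i -> F i = G i) -> fsum D F = fsum D G.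
Proof.
by move=> FG; apply/funext => m; apply: eq_fsbigr => i /set_mem /FG ->.
Qed.

Lemma eq_fsum_at F G m m' : (forall i, D i -> F i m = G i m') -> fsum D F m = fsum D G m'.
Proof. by move=> FG; apply: eq_fsbigr => i /set_mem /FG. Qed.

Lemma proj_fsum A F : proj A (fsum D F) = fsum D (fun i => proj A (F i)).
Proof.
apply/funext => m; rewrite /proj; case: ifP => fm.
  by apply: eq_fsum_at => i _; rewrite fm.
by rewrite fsum_eq0 // => i _; rewrite fm.
Qed.

Lemma fderiv_fsum v F : fderiv v (fsum D F) = fsum D (fun i => fderiv v (F i)).
Proof. by apply/funext => m; rewrite /fderiv /fsum mulr_fsumr. Qed.

Definition summable F := forall m, finite_set (D `&` [set i | F i m <> 0])%classic.

Lemma summable_seq F : summable F -> forall m, exists r : seq I,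
  [/\ uniq r, forall i, i \in r -> D i &
      forall a b i, mmul a b = m -> D i -> i \notin r -> F i a = 0].
Proof.
move=> sF m.
pose J := (\bigcup_(a in [set a | exists b, mmul a b = m]) (D `&` [set i | F i a <> 0]))%classic.
have fJ : finite_set J by apply: bigcup_finite => [|a _]; [exact: finite_divisors|exact: sF].
exists (fset_set J); split=> [|i|a b i e Di]; first exact: fset_uniq.
  by rewrite in_fset_set // => /set_mem [a _ []].
rewrite in_fset_set // => /negP nJ; apply/eqP/negPn/negP => /eqP nz; apply: nJ.
by apply/mem_set; exists a; [exists b|].
Qed.

Lemma fsumM F g : summable F -> fsum D F * g = fsum D (fun i => F i * g).
Proof.
move=> sF; apply/funext => m; have [r [ur rD out]] := summable_seq sF m.
transitivity (((\sum_(i <- r) F i) * g) m).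
  apply: eq_belowM (m) mone _; rewrite ?mulm1 // => a b e.
  by rewrite fps_sumE; apply: fsumE => // i Di ir; apply: out e Di ir.
rewrite mulr_suml fps_sumE; apply/esym/fsumE => // i Di ir.
by rewrite fpsME fsbig1 // => -[a b] /= e; rewrite (out a b) ?mul0r.
Qed.

Lemma fsumD F G : summable F -> summable G ->
  fsum D F + fsum D G = fsum D (fun i => F i + G i).
Proof.
move=> sF sG; apply/funext => m.
pose J := (D `&` [set i | F i m <> 0] `|` D `&` [set i | G i m <> 0])%classic.
have fJ : finite_set J by rewrite finite_setU.
have out i : D i -> i \notin fset_set J -> F i m = 0 /\ G i m = 0.
  move=> Di; rewrite in_fset_set // => /negP nJ.
  by split; apply/eqP/negPn/negP => /eqP nz; apply: nJ; apply/mem_set; [left|right].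
have inD i : i \in fset_set J -> D i by rewrite in_fset_set // => /set_mem [] [].
rewrite fpsDE !(@fsumE _ m (fset_set J)) ?fset_uniq //; first by rewrite -big_split.
all: by move=> i Di /out[] // e1 e2; rewrite ?(fpsDE (F i)) ?e1 ?e2 ?addr0.
Qed.

End Fsum.

Lemma fsum_nat (F : nat -> fps K) m N : (forall k, (N <= k)%N -> F k m = 0) ->
  fsum setT F m = (\sum_(k < N) F k) m.
Proof.
move=> out; rewrite fps_sumE (@fsumE _ _ _ _ (iota 0 N)) ?iota_uniq //.
  by rewrite -(big_mkord xpredT (fun k => F k m)) /index_iota subn0.
by move=> k _; rewrite mem_iota /= add0n -leqNgt => /out.
Qed.

Lemma summable_nat (F : nat -> fps K) (N : mono -> nat) :
  (forall m k, (N m <= k)%N -> F k m = 0) -> summable setT F.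
Proof.
move=> out m; apply: (@sub_finite_set _ _ `I_(N m)%classic); last exact: finite_II.
by move=> k [_ /= nz]; rewrite ltnNge; apply/negP => /out.
Qed.
Lemma fsum_fmon F : fsum setT (fun a : mono => F a *: fmon a) = F.
Proof.
apply/funext => m; rewrite (@fsum_single _ _ _ _ m) // => [|a _ am].
  by rewrite fpsZE fmonE eqxx mulr1.
by rewrite fpsZE fmonE eq_sym (negPf am) mulr0.
Qed.

Lemma summable_fmon F : summable setT (fun a : mono => F a *: fmon a).
Proof.
move=> m; apply: (@sub_finite_set _ _ [set m]%classic); last exact: finite_set1.
by move=> a [_ /=]; rewrite fpsZE fmonE; case: eqP => [->|]; rewrite ?mulr0.
Qed.

Lemma summableM (I : choiceType) (D : set I) (F : I -> fps K) g :
  summable D F -> summable D (fun i => F i * g).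
Proof.
move=> sF m; have [r [ur rD out]] := summable_seq sF m.
apply: (@sub_finite_set _ _ [set` r]%classic); last exact: finite_seq.
move=> i [Di /=]; apply: contra_notP => /negP ir.
by rewrite fpsME fsbig1 // => -[a b] /= e; rewrite (out a b) ?mul0r.
Qed.

Lemma fsum_reindex (I J : choiceType) (phi : I -> J) (F : J -> fps K) m :
  injective phi -> (forall j, (forall i, phi i <> j) -> F j m = 0) ->
  fsum setT F m = fsum setT (fun i => F (phi i)) m.
Proof.
move=> inj out; rewrite /fsum -(@fsbig_widen _ _ _ _ (range phi)) //.
  by rewrite fsbig_image // => x y _ _; exact: inj.
by move=> j [_ nr]; apply: out => i e; apply: nr; exists i.
Qed.

Lemma proj_sub A (B : pred var) f : (forall v, A v -> B v) -> proj A (proj B f) = proj A f.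
Proof.
move=> AB; apply/funext => m; rewrite /proj; case: ifP => // /allP fm.
by case: ifP => // /allP[] v /fm/AB.
Qed.

Lemma fderiv_proj A v f : A v -> fderiv v (proj A f) = proj A (fderiv v f).
Proof.
move=> Av; apply/funext => m; rewrite /fderiv /proj faceM faceU Av /=.
by case: ifP; rewrite ?mulr0.
Qed.

Lemma fderiv_proj0 A v f : ~~ A v -> fderiv v (proj A f) = 0.
Proof.
by move=> Av; apply/funext => m; rewrite /fderiv /proj faceM faceU (negPf Av) mulr0.
Qed.

End Series.

(** * Exponentials, substitutions and operators *)

Section Exponential.
Variable K : fieldType.
Hypothesis char0 : [pchar K] =i pred0.
Implicit Types (f g h : fps K) (m a b : mono) (A : pred var).

Let natK_neq0 n : (0 < n)%N -> n%:R != 0 :> K.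
Proof. by move=> n0; rewrite ((pcharf0P _).1 char0) -lt0n. Qed.

Let factK_neq0 n : n`!%:R != 0 :> K.
Proof. exact/natK_neq0/fact_gt0. Qed.

Lemma fpsX_low f k m : f mone = 0 -> (mdeg m < k)%N -> (f ^+ k) m = 0.
Proof.
move=> f0; elim: k m => // k IH m lt; rewrite exprS fpsME fsbig1 // => -[a b] /= e.
have [->|a1] := eqVneq a mone; first by rewrite f0 mul0r.
rewrite IH ?mulr0 // -ltnS; apply: leq_trans lt; rewrite ltnS -e mdegM.
by rewrite -[X in (X < _)%N]add0n ltn_add2r lt0n mdeg_eq0.
Qed.

Lemma fpsXM_low f g k m : f mone = 0 -> (mdeg m < k)%N -> (f ^+ k * g) m = 0.
Proof.
move=> f0 lt; rewrite fpsME fsbig1 // => -[a b] /= e.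
rewrite (fpsX_low f0) ?mul0r //; apply: leq_ltn_trans lt.
by rewrite -e mdegM leq_addr.
Qed.

Lemma summable_pow f (F : nat -> fps K) : f mone = 0 ->
  (forall k, exists g, F k = f ^+ k.-1 * g) -> summable setT F.
Proof.
move=> f0 FE; apply: (@summable_nat _ _ (fun m => (mdeg m).+2)) => m k lt.
by have [g ->] := FE k; rewrite fpsXM_low // -ltnS (ltn_predK lt).
Qed.

Lemma summable_exp f : f mone = 0 ->
  summable setT (fun k : nat => (k`!%:R)^-1 *: f ^+ k).
Proof.
move=> f0; apply: (summable_pow f0) => -[|k].
  by exists ((0`!%:R)^-1 *: 1); rewrite -scalerAr mulr1.
by exists ((k.+1`!%:R)^-1 *: f); rewrite -scalerAr -exprSr.
Qed.

Lemma fexp_trunc f m N : f mone = 0 -> (mdeg m < N)%N ->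
  fexp f m = (\sum_(k < N) (k`!%:R)^-1 *: f ^+ k) m.
Proof.
move=> f0 lt; apply: fsum_nat => k le.
by rewrite fpsZE fpsX_low ?mulr0 // (leq_trans lt).
Qed.

Lemma eq_below_fexp m f g : eq_below m f g -> fexp f m = fexp g m.
Proof.
move=> e; apply: eq_fsum_at => k _.
by rewrite !fpsZE (eq_below_at (eq_belowX k e)).
Qed.

Lemma fexp0 : fexp 0 = 1 :> fps K.
Proof.
apply/funext => m; rewrite /fexp (@fsum_single _ _ _ _ _ 0%N) //.
  by rewrite invr1 expr0 scale1r.
by move=> [|k] // _ _; rewrite expr0n scaler0.
Qed.

Lemma fexp_mone f : f mone = 0 -> fexp f mone = 1.
Proof.
move=> f0; rewrite (@fexp_trunc _ _ 1) // ?mdeg1 // big_ord1 expr0 fpsZE.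
by rewrite fps1E eqxx invr1 mulr1.
Qed.

Lemma fexpD f g : f mone = 0 -> g mone = 0 -> fexp (f + g) = fexp f * fexp g.
Proof.
move=> f0 g0; apply/funext => m; set N := (mdeg m).+1.
have fg0 : (f + g) mone = 0 by rewrite fpsDE f0 g0 addr0.
have low a b h : h mone = 0 -> mmul a b = m ->
    fexp h a = (\sum_(k < N) (k`!%:R)^-1 *: h ^+ k) a.
  by move=> h0 e; apply: fexp_trunc => //; rewrite ltnS -e mdegM leq_addr.
rewrite (fexp_trunc fg0 (ltnSn _)) -/N.
transitivity (((\sum_(k < N) (k`!%:R)^-1 *: f ^+ k) *
               (\sum_(k < N) (k`!%:R)^-1 *: g ^+ k)) m); last first.
  apply: eq_fpsM => a b e; rewrite (low a b) // (low b a) //.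
  by rewrite mulmC.
pose phi i j := ((i`!%:R)^-1 * (j`!%:R)^-1) *: (f ^+ i * g ^+ j).
have -> : (\sum_(k < N) (k`!%:R)^-1 *: (f + g) ^+ k) =
    \sum_(0 <= k < N) \sum_(0 <= j < N | (j <= k)%N) phi (k - j)%N j.
  rewrite big_mkord; apply: eq_bigr => -[k /= kN] _.
  rewrite exprDn scaler_sumr -(big_mkord xpredT
    (fun j => k`!%:R^-1 *: (f ^+ (k - j) * g ^+ j *+ 'C(k, j)))).
  rewrite (big_nat_widen _ _ N) //.
  apply: congr_big_nat => // j /andP[/andP[_ jk] _]; rewrite /phi -scaler_nat scalerA.
  rewrite ltnS in jk; congr (_ *: _); rewrite -(bin_fact jk) !natrM !invfM.
  by rewrite mulrC mulVKf ?natK_neq0 ?bin_gt0 // mulrC.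

rewrite (exchange_big_dep_nat xpredT) //= mulr_sumr !fps_sumE big_mkord.
apply: eq_bigr => -[j /= jN] _; rewrite mulr_suml.
have -> : \sum_(0 <= k < N | (j <= k)%N) phi (k - j)%N j = \sum_(0 <= i < N - j) phi i j.
  rewrite -(big_nat_widenl j 0 N xpredT) // -{1}[j]add0n big_addn.
  by apply: eq_bigr => i _; rewrite addnK.
rewrite -(big_mkord xpredT (fun i => i`!%:R^-1 *: f ^+ i * (j`!%:R^-1 *: g ^+ j))).
rewrite [in RHS](big_cat_nat (n := (N - j)%N)) ?leq_subr //= fpsDE.
rewrite [X in _ = _ + X]fps_sumE [X in _ = _ + X]big1_seq ?addr0.
  by congr (_ m); apply: eq_bigr => i _; rewrite /phi -scalerAl -scalerAr scalerA.
move=> i /andP[_]; rewrite mem_index_iota => /andP[le _].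
rewrite -scalerAl -scalerAr !fpsZE fpsME fsbig1 ?mulr0 // => -[a b] /= e.
have [lt|ge] := ltnP (mdeg a) i; first by rewrite (fpsX_low f0) ?mul0r.
rewrite (fpsX_low g0) ?mulr0 //.
have : (mdeg a + mdeg b < N)%N by rewrite -mdegM e.
move: le ge jN; lia.
Qed.

Lemma fexpN_mul f : f mone = 0 -> fexp (- f) * fexp f = 1.
Proof. by move=> f0; rewrite -fexpD ?fpsNE ?f0 ?oppr0 // addNr fexp0. Qed.

Lemma fexp_lreg f : f mone = 0 -> GRing.lreg (fexp f).
Proof.
move=> f0 g h /(congr1 ( *%R (fexp (- f)))).
by rewrite !mulrA fexpN_mul // !mul1r.
Qed.

Lemma proj_fexp A f : proj A (fexp f) = fexp (proj A f).
Proof. by rewrite proj_fsum; apply: eq_fsum => k _; rewrite linearZ /= rmorphXn. Qed.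

Lemma fexp_shift f g : f mone = 0 ->
  fsum setT (fun k : nat => (k`!%:R)^-1 *: (k%:R *: (f ^+ k.-1 * g))) = fexp f * g.
Proof.
move=> f0; rewrite fsumM; last exact: summable_exp.
apply/funext => m; rewrite (@fsum_nat _ _ _ (mdeg m).+2); last first.
  by move=> [|k] // lt; rewrite !fpsZE fpsXM_low ?mulr0.
rewrite (@fsum_nat _ _ _ (mdeg m).+1); last first.
  by move=> k lt; rewrite -scalerAl fpsZE fpsXM_low ?mulr0.
rewrite big_ord_recl scale0r scaler0 add0r !fps_sumE; apply: eq_bigr => i _.
rewrite -scalerAl scalerA !fpsZE /=; congr (_ * _).
rewrite /bump leq0n add1n factS natrM invfM mulrAC mulVf ?mul1r //.
exact: natK_neq0.
Qed.

Lemma fderiv_fexp v f : f mone = 0 -> fderiv v (fexp f) = fexp f * fderiv v f.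
Proof.
move=> f0; rewrite -fexp_shift // fderiv_fsum; apply: eq_fsum => k _.
by rewrite linearZ /= fderivX.
Qed.

(* Junk value: a nonzero constant term makes infinitely many summands contribute. *)
Lemma fexp_mone_eq0 f : f mone != 0 -> fexp f mone = 0.
Proof.
move=> f0; rewrite /fexp /fsum fsbig_dflt // setTI.
suff -> : ((fun k : nat => ((k`!%:R)^-1 *: f ^+ k) mone) @^-1` [set~ 0] = setT)%classic.
  exact: infinite_nat.
apply/seteqP; split=> // k _ /=; apply/eqP.
by rewrite fpsZE fpsX1E mulf_neq0 ?invr_eq0 ?factK_neq0 ?expf_neq0.
Qed.

Definition cont (L : fps K -> fps K) :=
  forall F : nat -> fps K, L (fsum setT F) = fsum setT (fun k => L (F k)).

Lemma opexp_eigen (L : {linear fps K -> fps K}) (T : fps K -> fps K) (X g : fps K) :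
  cont L -> X mone = 0 ->
  (forall f, L (T f) = X * L f) -> L (opexp T g) = fexp X * L g.
Proof.
move=> cL X0 LT; rewrite /opexp cL fsumM; last exact: summable_exp.
apply: eq_fsum => k _; rewrite linearZ /= -scalerAl; congr (_ *: _).
elim: k => [|k IH]; first by rewrite expr0 mul1r.
rewrite iterS LT IH. by rewrite exprS mulrA.
Qed.

Lemma iter_fderivE v i f m :
  iter i (fderiv v) f m = ((m v + i) ^_ i)%:R * f (mmul (mpow i (ucm v)) m).
Proof.
elim: i m => [|i IH] m /=; first by rewrite ffactn0 mul1r mul1m.
rewrite /fderiv -/(fderiv v) IH cmM cmUU add1n addSnnS mulrA.
rewrite -natrM mulnC; congr (_%:R * f _).
  by move: (m v) => n; rewrite ffactnSr; congr (_ * _)%N; lia.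
by rewrite mulmA (mulmC (mpow _ _)).
Qed.

Lemma big_mmulE (I : Type) (r : seq I) (F : I -> mono) v :
  (\big[mmul/mone]_(i <- r) F i) v = (\sum_(i <- r) F i v)%N.
Proof. by apply: (big_morph (fun m : mono => m v)) => [a b|]; rewrite ?cmM ?cm1. Qed.

Lemma sum_finsupp_single m v (F : var -> nat) :
  (forall w, w \in finsupp m -> w != v -> F w = 0%N) -> (v \notin finsupp m -> F v = 0%N) ->
  (\sum_(w <- finsupp m) F w)%N = F v.
Proof.
move=> F0 Fv; have [vm|vm] := boolP (v \in finsupp m).
  rewrite (big_fsetD1 v) //= big1_seq ?addn0 // => w /andP[_].
  by rewrite !inE => /andP[? ?]; apply: F0.
rewrite big1_seq ?Fv // => w /andP[_ wm]; apply: F0 => //.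
by apply: contraNneq vm => <-.
Qed.

Lemma prod_fvar m : \prod_(v <- finsupp m) fvar K v ^+ m v = fmon K m.
Proof.
transitivity (fmon K (\big[mmul/mone]_(v <- finsupp m) mpow (m v) (ucm v))).
  rewrite (big_morph (fmon K) (@fmon_mul K) (fmon1 K)).
  by apply: eq_bigr => v _; rewrite fmonX.
congr fmon; apply: monoP => v; rewrite big_mmulE (@sum_finsupp_single _ v).
- by rewrite mpowE cmUU muln1.
- by move=> w _ wv; rewrite mpowE cmU (negPf wv) muln0.
- by rewrite -cmE_eq0 => /eqP; rewrite mpowE => ->.
Qed.

Lemma prod_finsuppM (c : var -> fps K) a b :
  \prod_(v <- finsupp (mmul a b)) c v ^+ mmul a b v =
  \prod_(v <- finsupp a) c v ^+ a v * \prod_(v <- finsupp b) c v ^+ b v.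
Proof.
have widen m (d : {fset var}) : {subset finsupp m <= d} ->
    \prod_(v <- finsupp m) c v ^+ m v = \prod_(v <- d) c v ^+ m v.
  move=> /fsubsetP sub; rewrite (big_fset_incl _ sub) // => v _.
  by rewrite -cmE_eq0 => /eqP->.
rewrite (widen a (finsupp (mmul a b))); last by move=> v; rewrite mdomD inE => ->.
rewrite (widen b (finsupp (mmul a b))); last by move=> v; rewrite mdomD inE orbC => ->.
by rewrite -big_split; apply: eq_bigr => v _; rewrite cmM exprD.
Qed.

Lemma fsubst_proj A f : fsubst (fun v => if A v then fX K v else 0) f = proj A f.
Proof.
have E m : \prod_(v <- finsupp m) (if A v then fX K v else 0) ^+ m v =
    if face A m then fmon K m else 0.
  case: ifP => [/allP fm|/negbT /allPn [v vm Av]].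
    by rewrite -prod_fvar; apply: eq_big_seq => v /fm ->; rewrite fXE.
  rewrite (big_fsetD1 v) //= (negPf Av) expr0n.
  by move: vm; rewrite -cmE_neq0 => /negPf->; rewrite mul0r.
apply/funext => m; rewrite /fsubst /proj (@fsum_single _ _ _ _ _ m) //.
  by rewrite fpsZE E; case: ifP => _; rewrite ?mulr0 // fmonE eqxx mulr1.
move=> a _ am; rewrite fpsZE E; case: ifP => _; last by rewrite mulr0.
by rewrite fmonE eq_sym (negPf am) mulr0.
Qed.

Lemma at_s0E f : at_s0 f = proj (fun v => if v is vs _ then false else true) f.
Proof. by rewrite -fsubst_proj; congr (fsubst _ f); apply/funext => -[]. Qed.

Lemma at_q0E f : at_q0 f = proj (fun v => if v is vq _ then false else true) f.
Proof. by rewrite -fsubst_proj; congr (fsubst _ f); apply/funext => -[]. Qed.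

Lemma coefzE i f m :
  coefz i f m = if m vz == 0%N then f (mmul (mpow i (ucm vz)) m) else 0.
Proof.
rewrite /coefz; set sigma := fun v => _.
have -> : sigma = fun v => if v != vz then fX K v else 0.
  by apply/funext => v; case: eqVneq => [->|]; case: v.
rewrite (fsubst_proj (fun v => v != vz)) fpsZE /proj.
have -> : face (fun v => v != vz) m = (m vz == 0%N).
  apply/faceP/eqP => [/(_ vz)|mz v /negPn/eqP->] //; exact.
case: eqP => [mz|]; last by rewrite mulr0.
by rewrite iter_fderivE mz add0n ffactnn mulrA mulVf ?mul1r.
Qed.

Lemma opmono_single (T : var -> fps K -> fps K) v m f :
  (forall w g, w \in finsupp m -> w != v -> T w g = g) ->
  opmono T m f = iter (m v) (T v) f.
Proof.
move=> Tid; rewrite /opmono.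
have idw w g : w \in finsupp m -> w != v -> iter (m w) (T w) g = g.
  by move=> wm wv; elim: (m w) => //= k ->; apply: Tid.
have nov (r : seq var) : {subset r <= finsupp m} -> v \notin r ->
    foldr (fun w g => iter (m w) (T w) g) f r = f.
  elim: r => //= w r IH sub; rewrite inE negb_or => /andP[vw vr].
  rewrite IH // => [|x xr]; last by apply: sub; rewrite inE xr orbT.
  by apply: idw; rewrite 1?eq_sym //; apply: sub; rewrite inE eqxx.
have [vm|vm] := boolP (v \in finsupp m); last first.
  by rewrite nov // (eqP (_ : m v == 0%N)) // cmE_eq0.
suff gen (r : seq var) : {subset r <= finsupp m} -> uniq r -> v \in r ->
    foldr (fun w g => iter (m w) (T w) g) f r = iter (m v) (T v) f.
  by apply: gen => //; exact: fset_uniq.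
elim: r => //= w r IH sub /andP[wr ur] vr.
have subr : {subset r <= finsupp m} by move=> x xr; apply: sub; rewrite inE xr orbT.
have [e|ne] := eqVneq v w; first by rewrite -e nov ?e.
move: vr; rewrite inE (negPf ne) /= => vr.
by rewrite IH // idw // 1?eq_sym //; apply: sub; rewrite inE eqxx.
Qed.

Lemma opmono_mul (T D : var -> fps K -> fps K) (c : var -> fps K) m f :
  (forall v g, v \in finsupp m -> T v g = c v * D v g) ->
  (forall v w g, v \in finsupp m -> w \in finsupp m -> D v (c w * g) = c w * D v g) ->
  opmono T m f = \prod_(v <- finsupp m) c v ^+ m v * opmono D m f.
Proof.
move=> TE DC; rewrite /opmono.
suff gen (r : seq var) : {subset r <= finsupp m} ->
    foldr (fun v h => iter (m v) (T v) h) f r =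
    \prod_(v <- r) c v ^+ m v * foldr (fun v h => iter (m v) (D v) h) f r.
  exact: gen.
elim: r => [|v r IH] sub /=; first by rewrite big_nil mul1r.
have vm : v \in finsupp m by apply: sub; rewrite inE eqxx.
have subr : {subset r <= finsupp m} by move=> w wr; apply: sub; rewrite inE wr orbT.
have DX w k g : w \in finsupp m -> D v (c w ^+ k * g) = c w ^+ k * D v g.
  by move=> wm; elim: k g => [|k IHk] g; rewrite ?mul1r // exprS -!mulrA DC ?IHk.
have DP (s : seq var) g : {subset s <= finsupp m} ->
    D v (\prod_(w <- s) c w ^+ m w * g) = \prod_(w <- s) c w ^+ m w * D v g.
  elim: s g => [|w s IHs] g sub_s; rewrite ?big_nil ?mul1r // big_cons -!mulrA DX.
    by rewrite IHs // => x xs; apply: sub_s; rewrite inE xs orbT.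
  by apply: sub_s; rewrite inE eqxx.
rewrite big_cons IH //; set h := foldr _ f r; elim: (m v) => [|k IHk] /=.
  by rewrite mul1r.
by rewrite IHk TE // -mulrA DX // DP // exprS -!mulrA.
Qed.

End Exponential.

(** * The Hamiltonians *)

Lemma Khbar_char0 (R : numFieldType) : [pchar Khbar R] =i pred0.
Proof.
apply/pcharf0P => n; rewrite -(rmorph_nat (@tofrac {poly R})) tofrac_eq0.
by rewrite -polyC_natr polyC_eq0 pnatr_eq0.
Qed.

Lemma hbar_neq0 (R : numFieldType) : hbar R != 0.
Proof. by rewrite tofrac_eq0 polyX_eq0. Qed.

Definition freq_of (v : var) : int :=
  match v with vp k => k%:Z | vq k => - k%:Z | _ => 0 end.

Lemma xfreqEw (m : mono) (d : {fset var}) : {subset finsupp m <= d} ->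
  xfreq m = \sum_(v <- d) freq_of v * (m v)%:Z.
Proof.
move=> /fsubsetP sub; rewrite /xfreq (big_fset_incl _ sub) // => v _.
by rewrite -cmE_eq0 => /eqP->; rewrite mulr0.
Qed.

Lemma xfreqM (a b : mono) : xfreq (mmul a b) = xfreq a + xfreq b.
Proof.
rewrite (@xfreqEw a (finsupp (mmul a b))); last by move=> v; rewrite mdomD inE => ->.
rewrite (@xfreqEw b (finsupp (mmul a b))); last by move=> v; rewrite mdomD inE orbC => ->.
rewrite -big_split; apply: eq_bigr => v _ /=.
by rewrite -mulrDr cmM PoszD.
Qed.

Lemma xfreq1 : xfreq mone = 0. Proof. by rewrite /xfreq mdom1 big_seq_fset0. Qed.

Lemma xfreqU v : xfreq (ucm v) = freq_of v.
Proof. by rewrite /xfreq mdomU big_seq_fset1 cmUU mulr1. Qed.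

Lemma xfreq_le0 (m : mono) : (forall k, m (vp k) = 0%N) -> xfreq m <= 0.
Proof.
move=> m0; apply: sumr_le0 => -[n|k|k|] _; rewrite ?mul0r // ?m0 ?mulr0 //.
by rewrite mulNr oppr_le0.
Qed.

Lemma xfreq_eq0 (A : pred var) (m : mono) :
  (forall v, A v -> freq_of v = 0) -> face A m -> xfreq m = 0.
Proof.
move=> A0 /allP fm; rewrite /xfreq big1_seq // => v /andP[_ /fm /A0 e].
by rewrite -/(freq_of v) e mul0r.
Qed.

Definition pq_var v := match v with vp k | vq k => (0 < k)%N | _ => false end.

Lemma face_pq_noP (m : mono) : face pq_var m -> (forall k, m (vp k) = 0%N) -> xfreq m = 0 ->
  m = mone.
Proof.
move=> /faceP fm m0 x0; apply: monoP => v; rewrite cm1.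
apply/eqP/negPn/negP => mv.
have: pq_var v by apply: contraR mv => /fm->.
case: v mv => // k mk /= k0; first by rewrite m0 in mk.
have := mmul_ucm mk; set c := divcm _ _ => e.
have : xfreq c <= 0 by apply: xfreq_le0 => j; rewrite divcmE m0.
have : - k%:Z + xfreq c = 0 by rewrite -x0 -e xfreqM xfreqU.
by move: (xfreq c) k0 => x; lia.
Qed.

Definition p1q1 : mono := mmul (ucm (vp 1)) (ucm (vq 1)).

Lemma face_pq_P1 (m : mono) : face pq_var m -> (forall k, k != 1%N -> m (vp k) = 0%N) ->
  m (vp 1) = 1%N -> xfreq m = 0 -> m = p1q1.
Proof.
move=> fm m0 m1 x0; have mp : m (vp 1) != 0%N by rewrite m1.
have := mmul_ucm mp; set b := divcm _ _ => e.
have b0 k : b (vp k) = 0%N.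
  by rewrite divcmE; have [->|/m0->] := eqVneq k 1%N; rewrite ?m1 ?cmUU.
have xb : 1 + xfreq b = 0 by rewrite -x0 -e xfreqM xfreqU.
move: fm; rewrite -e faceM => /andP[_ fb].
have [v vb] : exists v, b v != 0%N.
  apply: contrapT => /forallNP b1; move: xb; suff -> : b = mone by rewrite xfreq1.
  by apply: monoP => v; rewrite cm1; apply/eqP/negPn/negP/b1.
have : pq_var v by apply: contraR vb => /(faceP _ _ fb)->.
case: v vb => // k bk k0; first by rewrite b0 in bk.
have := mmul_ucm bk; set c := divcm _ _ => ec.
have c0 j : c (vp j) = 0%N by rewrite divcmE b0.
have := xfreq_le0 c0; move: xb; rewrite -ec xfreqM xfreqU /= => xc lec.
have k1 : k = 1%N by move: (xfreq c) xc lec k0 => x /=; lia.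
rewrite (face_pq_noP (m := c)) ?mulm1 ?k1 //.
  by move: fb; rewrite -ec faceM => /andP[].
by move: xc; rewrite k1; move: (xfreq c) => x; lia.
Qed.

(* The constructions of the statement, over an arbitrary field instead of [Khbar R] and
   with [X] for [fX]: unification in the concrete field is prohibitively slow, and the
   proofs use the locked variables [fvar]. *)
Section Constructions.
Variables (K : fieldType) (hb : K) (X : var -> fps K).
Implicit Types (F f : fps K).

Definition S_coef (j : nat) : K := ((4 ^ j * (j.*2.+1)`!)%:R)^-1.
Definition S_series : fps K := fsum setT (fun j : nat => (S_coef j * hb ^+ j) *: X vz ^+ j.*2).
Definition freq_op f : fps K := fun m => - (xfreq m)%:~R * f m.
Definition circle_mean f : fps K := fun m => if xfreq m == 0 then f m else 0.
Definition u_series : fps K :=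
  fsum [set k : nat | (0 < k)%N]%classic (fun k => X (vp k) + X (vq k)).
Definition S_freq f : fps K :=
  fsum setT (fun j : nat => (S_coef j * hb ^+ j) *: (X vz ^+ j.*2 * iter j.*2 freq_op f)).
Definition ham_series : fps K :=
  Defs.finv S_series * circle_mean (fexp (X vz * S_freq u_series)).
Definition ham (n : nat) : fps K := hb^-1 *: coefz n.+2 ham_series.

Definition left_act F f : fps K :=
  fsum setT (fun m : mono => F m *:
    opmono (fun v => if v is vp k then *%R (X (vp k)) else id) m
      (opmono (fun v => if v is vq k then fun g => (k%:R * hb) *: fderiv (vp k) g
                        else id) m f)).

Definition right_act F f : fps K :=
  fsum setT (fun m : mono => F m *:
    opmono (fun v => if v is vp k
                     then fun g => (hb * k%:R) *: (X vz ^+ k * fderiv (vq k) g)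
                     else *%R (X v)) m f).
End Constructions.

Section Hamiltonian.
Variables (K : fieldType) (hb : K).
Implicit Types (f g h : fps K) (m a b : mono) (A : pred var).
Local Notation z := (fvar K vz).
Local Notation X := (fun v => fvar K v).
Local Notation S_series := (S_series hb X).
Local Notation u_series := (u_series X).
Local Notation S_freq := (S_freq hb X).
Local Notation ham_series := (ham_series hb X).
Local Notation ham := (ham hb X).
Local Notation S_coef := (S_coef K).
Local Notation freq_op := (@freq_op K).

Lemma iter_freq_opE k f m : iter k freq_op f m = (- (xfreq m)%:~R) ^+ k * f m.
Proof. by elim: k => [|k IH] /=; rewrite ?mul1r // /freq_op IH mulrA exprS. Qed.

Lemma proj_freq_op A k f : proj A (iter k freq_op f) = iter k freq_op (proj A f).
Proof.
apply/funext => m; rewrite iter_freq_opE /proj; case: ifP => _; last by rewrite mulr0.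
by rewrite iter_freq_opE.
Qed.

Lemma proj_circle_mean A f : proj A (circle_mean f) = circle_mean (proj A f).
Proof. by apply/funext => m; rewrite /proj /circle_mean; case: ifP; case: ifP. Qed.

Lemma proj_id_face A f m : proj A f = f -> f m <> 0 -> face A m.
Proof. by move=> <-; rewrite /proj; case: ifP. Qed.

Lemma z_pow k : z ^+ k = fmon K (mpow k (ucm vz)).
Proof. by rewrite fmonX. Qed.

Definition Zcoef (n : nat) : K := if odd n then 0 else S_coef n./2 * hb ^+ n./2.

Lemma S_seriesE n : S_series (mpow n (ucm vz)) = Zcoef n.
Proof.
have F0 j : n != j.*2 ->
    ((S_coef j * hb ^+ j) *: z ^+ j.*2) (mpow n (ucm vz)) = 0.
  move=> ne; rewrite fpsZE z_pow fmonE; case: eqP => [/(congr1 (fun m : mono => m vz))|].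
    by rewrite !mpowE cmUU !muln1 => e; rewrite e eqxx in ne.
  by rewrite mulr0.
rewrite /Zcoef; case: (boolP (odd n)) => no.
  apply: fsum_eq0 => j _; apply: F0; apply: contraTneq no => ->.
  by rewrite odd_double.
have en : n = (n./2).*2 by rewrite -[LHS]odd_double_half (negPf no).
rewrite /S_series (@fsum_single _ _ _ _ _ n./2) // => [|j _ ne].
  by rewrite fpsZE z_pow -en fmonE eqxx mulr1.
by apply: F0; apply: contra ne => /eqP->; rewrite doubleK.
Qed.

Lemma proj_S A : A vz -> proj A S_series = S_series.
Proof.
move=> Az; rewrite proj_fsum; apply: eq_fsum => j _.
by rewrite linearZ /= rmorphXn /= proj_fvar Az.
Qed.

Lemma proj_finv A f : proj A (Defs.finv f) = Defs.finv (proj A f).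
Proof.
by rewrite proj_fsum; apply: eq_fsum => k _; rewrite rmorphXn /= rmorphB rmorph1.
Qed.

Lemma fderiv_S v : v != vz -> fderiv v S_series = 0.
Proof.
move=> vz'; rewrite fderiv_fsum; apply/funext => m; apply: fsum_eq0 => j _.
by rewrite linearZ /= fderivX fderiv_fvar (negPf vz') mulr0 !scaler0.
Qed.

Lemma fderiv_finv v f : fderiv v f = 0 -> fderiv v (Defs.finv f) = 0.
Proof.
move=> f0; rewrite fderiv_fsum; apply/funext => m; apply: fsum_eq0 => k _.
rewrite fderivX raddfB /= f0 subr0 -(expr0 (1 : fps K)) fderivX scale0r.
by rewrite mulr0 scaler0.
Qed.

Lemma finv_mul f : f mone = 1 -> Defs.finv f * f = 1.
Proof.
move=> f1; have e0 : (1 - f) mone = 0 by rewrite fpsDE fpsNE f1 fps1E eqxx subrr.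
rewrite fsumM; last first.
  apply: (summable_pow e0) => -[|k]; first by exists 1; rewrite mulr1.
  by exists (1 - f); rewrite -exprSr.
apply/funext => m; rewrite (@fsum_nat _ _ _ (mdeg m).+1) => [|k lt]; last first.
  exact: fpsXM_low.
rewrite -mulr_suml -[f in _ * f](subKr 1) mulrC.
rewrite [X in (_ - X) * _](_ : _ = 1 - f) //.
have := subrX1 (1 - f) (mdeg m).+1; move/(congr1 -%R).
rewrite -mulNr !opprB => <-.
by rewrite fpsDE fpsNE fpsX_low // subr0.
Qed.

Lemma S_mone : S_series mone = 1.
Proof.
rewrite -[mone]/(mpow 0 (ucm vz)) S_seriesE /Zcoef /S_coef.
by rewrite expr0 mulr1 expn0 mul1n invr1.
Qed.

Definition Zvar v := if v is vz then true else false.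

Let p1 := vp 1. Let q1 := vq 1.

Lemma proj_u A : proj A u_series =
  fsum [set k : nat | (0 < k)%N]%classic
    (fun k => (if A (vp k) then fvar K (vp k) else 0) + (if A (vq k) then fvar K (vq k) else 0)).
Proof.
by rewrite proj_fsum; apply: eq_fsum => k _; rewrite linearD /= !proj_fvar.
Qed.

Lemma proj_S_freq A f : A vz -> proj A (S_freq f) = S_freq (proj A f).
Proof.
move=> Az; rewrite proj_fsum; apply: eq_fsum => j _.
by rewrite linearZ /= rmorphM /= rmorphXn /= proj_fvar Az proj_freq_op.
Qed.

Lemma S_freq0 : S_freq (0 : fps K) = 0.
Proof.
apply/funext => m; apply: fsum_eq0 => j _.
rewrite [iter _ _ _](_ : _ = 0) ?mulr0 ?scaler0 //.
by apply/funext => a; rewrite iter_freq_opE mulr0.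
Qed.

Lemma projZ_u : proj Zvar u_series = 0.
Proof. by rewrite proj_u; apply/funext => m; apply: fsum_eq0 => k _; rewrite addr0. Qed.

Lemma fderiv_zM v j f : v != vz -> fderiv v (z ^+ j * f) = z ^+ j * fderiv v f.
Proof.
move=> vz'; rewrite fderivM fderivX fderiv_fvar (negPf vz').
by rewrite mulr0 scaler0 mul0r add0r.
Qed.

Lemma projZ_fderiv_S_freq v f : v != vz ->
  (forall j m, face Zvar m -> fderiv v (iter j.*2 freq_op f) m = fderiv v f m) ->
  proj Zvar (fderiv v (S_freq f)) = S_series * proj Zvar (fderiv v f).
Proof.
move=> vz' fE; rewrite fsumM; last first.
  apply: (@summable_nat _ _ (fun m => (m vz).+1)) => m j lt.
  rewrite fpsZE z_pow -[fmon _ _]mulr1 fmonM0 ?mulr0 //; exists vz.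
  by rewrite mpowE cmUU muln1 -addnn (leq_trans lt) ?leq_addr.
rewrite fderiv_fsum proj_fsum; apply: eq_fsum => j _.
rewrite !linearZ /= fderiv_zM //.
rewrite rmorphM /= rmorphXn /= proj_fvar /= -scalerAl; congr (_ *: (_ * _)).
by apply/funext => m; rewrite /proj; case: ifP => // /fE.
Qed.

Lemma projZ_dS_u v (s : int) : v != vz -> xfreq (ucm v) = s -> s ^+ 2 = 1 ->
  proj Zvar (fderiv v u_series) = 1 ->
  proj Zvar (fderiv v (S_freq u_series)) = S_series.
Proof.
move=> vz' xv s2 u1; rewrite projZ_fderiv_S_freq ?u1 ?mulr1 // => j m fm.
rewrite /fderiv iter_freq_opE xfreqM xv (@xfreq_eq0 Zvar m) ?addr0 //; last by case.
rewrite -mul2n exprM sqrrN -rmorphXn /= s2 expr1n mul1r.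
by [].
Qed.

Lemma projZ_dp_u : proj Zvar (fderiv p1 u_series) = 1.
Proof.
rewrite fderiv_fsum proj_fsum; apply/funext => m.
rewrite (@fsum_single _ _ _ _ _ 1%N) // => [|k _ k1].
  by rewrite linearD /= !fderiv_fvar eqxx addr0 rmorph1.
rewrite linearD /= !fderiv_fvar.
have /negPf-> : vp 1 != vp k by apply: contra k1 => /eqP[->].
by rewrite addr0 linear0.
Qed.

Lemma projZ_dq_u : proj Zvar (fderiv q1 u_series) = 1.
Proof.
rewrite fderiv_fsum proj_fsum; apply/funext => m.
rewrite (@fsum_single _ _ _ _ _ 1%N) // => [|k _ k1].
  by rewrite linearD /= !fderiv_fvar eqxx add0r rmorph1.
rewrite linearD /= !fderiv_fvar.
have /negPf-> : vq 1 != vq k by apply: contra k1 => /eqP[->].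
by rewrite addr0 linear0.
Qed.

Lemma fderiv_nat v n : fderiv v (n%:R : fps K) = 0.
Proof. by rewrite raddfMn /= -(expr0 (1 : fps K)) fderivX scale0r mul0rn. Qed.

Lemma dpdq_u : fderiv p1 (fderiv q1 u_series) = 0.
Proof.
rewrite !fderiv_fsum; apply/funext => m; apply: fsum_eq0 => k _.
by rewrite !linearD /= !fderiv_fvar !fderiv_nat addr0.
Qed.

Lemma projZ_dpdq_S_u : proj Zvar (fderiv p1 (fderiv q1 (S_freq u_series))) = 0.
Proof.
rewrite !fderiv_fsum proj_fsum; apply/funext => m; apply: fsum_eq0 => j _.
rewrite !linearZ /= !fderiv_zM // rmorphM /=.
suff -> : proj Zvar (fderiv p1 (fderiv q1 (iter j.*2 freq_op u_series))) = 0.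
  by rewrite mulr0 scaler0.
apply/funext => a; rewrite /proj; case: ifP => // fa.
have /(congr1 (fun f : fps K => f a)) := dpdq_u.
rewrite /fderiv iter_freq_opE => e; move: (_ ^+ _) => x.
by rewrite [_%:R * (x * _)]mulrCA [LHS]mulrCA e mulr0.
Qed.

Lemma zM_mone f : (z * f) mone = 0.
Proof. by rewrite fpsM1E fmonE eq_sym cm1_eq1 mul0r. Qed.

Hypothesis char0 : [pchar K] =i pred0.

Lemma projZ_dpdq_exp :
  proj Zvar (fderiv p1 (fderiv q1 (fexp (z * S_freq u_series)))) = z ^+ 2 * S_series ^+ 2.
Proof.
set Y := z * _; have Y0 : Y mone = 0 by exact: zM_mone.
have dY v : v != vz -> fderiv v Y = z * fderiv v (S_freq u_series).
  by move=> vz'; exact: (@fderiv_zM v 1).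
rewrite !(fderiv_fexp char0) // fderivM (fderiv_fexp char0) // rmorphD !rmorphM /=.
rewrite proj_fexp rmorphM /= proj_S_freq // projZ_u S_freq0 mulr0 fexp0 !mul1r.
rewrite !dY // (@fderiv_zM p1 1) // !rmorphM /= projZ_dpdq_S_u mulr0 addr0.
have -> : proj Zvar (fderiv p1 (S_freq u_series)) = S_series.
  by rewrite (projZ_dS_u (s := 1)) ?xfreqU ?projZ_dp_u.
have -> : proj Zvar (fderiv q1 (S_freq u_series)) = S_series.
  by rewrite (projZ_dS_u (s := -1)) ?xfreqU ?projZ_dq_u.
by rewrite proj_fvar /= mulrACA -!expr2.
Qed.

Lemma ham_series_p1q1 n : ham_series (mmul (mpow n.+2 (ucm vz)) p1q1) = Zcoef n.
Proof.
have Sv v : v != vz -> fderiv v (Defs.finv S_series) = 0.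
  by move=> vz'; rewrite fderiv_finv ?fderiv_S.
have : proj Zvar (fderiv p1 (fderiv q1 ham_series)) = z ^+ 2 * S_series.
  rewrite /ham_series fderivM Sv // mul0r add0r fderivM Sv // mul0r add0r rmorphM /=.
  rewrite proj_finv proj_S //.
  rewrite [X in _ * X](_ : _ = z ^+ 2 * S_series ^+ 2).
    by rewrite mulrCA (expr2 S_series) [Defs.finv _ * _]mulrA finv_mul ?S_mone ?mul1r.
  rewrite -projZ_dpdq_exp; apply/funext => m; rewrite /proj; case: ifP => // fm.
  rewrite /fderiv /circle_mean !xfreqM !xfreqU (@xfreq_eq0 Zvar m) ?eqxx //.
  by case.
have : face Zvar (mpow n.+2 (ucm vz)) by exact: face_mpow.
set M := mpow n.+2 _ => fz /(congr1 (fun f : fps K => f M)).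
have [Mp Mq] : M p1 = 0%N /\ M q1 = 0%N by split; apply: (faceP _ _ fz).
rewrite /= projE // /fderiv (cmM q1 (ucm p1) M) Mp Mq cmU addn0 !mul1r.
rewrite mulmA (mulmC (ucm q1)) (mulmC M) => ->.
have -> : M = mmul (mpow 2 (ucm vz)) (mpow n (ucm vz)).
  by rewrite /M /= mulm1 mulmA.
by rewrite z_pow fmonM S_seriesE.
Qed.

Definition ham_var v := match v with vp k | vq k => (0 < k)%N | vz => true | _ => false end.

Lemma proj_ham : proj ham_var ham_series = ham_series.
Proof.
rewrite /ham_series rmorphM /= proj_finv proj_S // proj_circle_mean proj_fexp rmorphM /=.
have pu : proj ham_var u_series = u_series by rewrite proj_u; apply: eq_fsum => k /= ->.
have pz : proj ham_var z = z by rewrite proj_fvar.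
by rewrite (proj_S_freq _ (isT : ham_var vz)) pu pz.
Qed.

Lemma ham_series_freq m : ham_series m <> 0 -> xfreq m = 0.
Proof.
move=> nz; apply: contrapT => /eqP x0; apply: nz; rewrite /ham_series fpsME.
rewrite fsbig1 // => -[a b] /= e.
have Sz : proj Zvar (Defs.finv S_series) = Defs.finv S_series by rewrite proj_finv proj_S.
rewrite -Sz /proj; case: ifP => fa; last by rewrite mul0r.
rewrite /circle_mean; case: eqP => [xb|]; last by rewrite mulr0.
move: x0; rewrite -e xfreqM xb addr0 (xfreq_eq0 (A := Zvar)) ?eqxx //.
by case.
Qed.

Lemma ham_p1q1 n : ham n p1q1 = hb^-1 * Zcoef n.
Proof. by rewrite /ham fpsZE (coefzE char0) cmM !cmU /= ham_series_p1q1. Qed.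

Lemma ham_supp n m : ham n m <> 0 -> face pq_var m /\ xfreq m = 0.
Proof.
rewrite /ham fpsZE (coefzE char0); case: eqP => [mz|_]; last by rewrite mulr0.
move=> nz; have {}nz : ham_series (mmul (mpow n.+2 (ucm vz)) m) <> 0.
  by move=> e; apply: nz; rewrite e mulr0.
have xz : xfreq (mpow n.+2 (ucm vz)) = 0.
  by apply: (xfreq_eq0 (A := Zvar)); [case|exact: face_mpow].
split; last by move: (ham_series_freq nz); rewrite xfreqM xz add0r.
have := proj_id_face proj_ham nz; rewrite faceM => /andP[_ /faceP fm].
by apply/faceP => -[k|k|k|] //= Av; rewrite fm.
Qed.

End Hamiltonian.

(** * The cap in degree one *)

Section DegreeOneCap.
Variables (K : fieldType) (hb : K).
Hypothesis char0 : [pchar K] =i pred0.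
Implicit Types (f g h F : fps K) (m a b : mono) (A : pred var).
Local Notation X := (fun v => fvar K v).
Local Notation ham := (ham hb X).
Local Notation left_act := (left_act hb X).
Let p1 := vp 1.

Definition s_var v := if v is vs _ then true else false.

(* The part linear in [v] (for [v] not an [s]-variable) and constant in the other
   variables outside [s]. *)
Definition lin_part v : fps K -> fps K := proj s_var \o fderiv v.
HB.instance Definition _ v := GRing.Linear.on (lin_part v).

Lemma lin_partE v f m : ~~ s_var v ->
  lin_part v f m = if face s_var m then f (mmul (ucm v) m) else 0.
Proof.
move=> sv; rewrite /lin_part /= /proj; case: ifP => // fm.
by rewrite /fderiv (faceP _ _ fm) // mul1r.
Qed.

Lemma lin_partM v f g :
  lin_part v (f * g) = lin_part v f * proj s_var g + proj s_var f * lin_part v g.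
Proof. by rewrite /lin_part /= fderivM rmorphD !rmorphM. Qed.

Lemma lin_part_fexp v f : f mone = 0 ->
  lin_part v (fexp f) = fexp (proj s_var f) * lin_part v f.
Proof. by move=> f0; rewrite /lin_part /= (fderiv_fexp char0) // rmorphM /= proj_fexp. Qed.

Lemma lin_part_fsum v (I : choiceType) (D : set I) (G : I -> fps K) :
  lin_part v (fsum D G) = fsum D (fun i => lin_part v (G i)).
Proof. by rewrite /lin_part /= fderiv_fsum proj_fsum. Qed.

Lemma lin_part_fvar v w : lin_part v (fvar K w) = (v == w)%:R.
Proof. by rewrite /lin_part /= fderiv_fvar rmorph_nat. Qed.

Definition left_term a f : fps K :=
  opmono (fun v => if v is vp k then *%R (fvar K (vp k)) else id) a
      (opmono (fun v => if v is vq k then fun g => (k%:R * hb) *: fderiv (vp k) g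
                        else id) a f).

Lemma left_term_eq0 a f m k : (m (vp k) < a (vp k))%N -> left_term a f m = 0.
Proof.
move=> lt; rewrite /left_term; set h := opmono _ a f.
rewrite (@opmono_mul _ _ (fun _ => id) (fun v => if v is vp k then fvar K (vp k) else 1)) //.
  have ka : vp k \in finsupp a by rewrite -cmE_neq0 -lt0n (leq_ltn_trans _ lt).
  rewrite (big_fsetD1 (vp k)) //= fmonX -!mulrA fmonM0 //; exists (vp k).
  by rewrite mpowE cmUU muln1.
by move=> [n|j|j|] g _ //; rewrite mul1r.
Qed.

Lemma left_term1 f : left_term mone f = f.
Proof. by rewrite /left_term /opmono !mdom1. Qed.

Lemma left_term_p1q1 f m : m p1 = 0%N ->
  left_term p1q1 f (mmul (ucm p1) m) = hb * f (mmul (ucm p1) m).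
Proof.
move=> mp; rewrite /left_term.
have supp v : v \in finsupp p1q1 -> v = vp 1 \/ v = vq 1.
  by rewrite mdomD !mdomU !inE => /orP[] /eqP; [left|right].
rewrite (@opmono_single _ _ (vp 1)); last by move=> w g /supp [] ->.
rewrite (@opmono_single _ _ (vq 1)); last by move=> w g /supp [] ->.
rewrite /p1q1 !cmM !cmU !eqxx /= fmonM fpsZE mul1r /fderiv mp.
by rewrite mul1r.
Qed.

(* A monomial of [ham n] with no p has frequency 0 and hence no q either; one with a p does
   not contribute to the coefficients free of p. *)
Lemma proj_left_act n f :
  proj s_var (left_act (ham n) f) = ham n mone *: proj s_var f.
Proof.
apply/funext => m; rewrite fpsZE /proj; case: ifP => [fm|]; last by rewrite mulr0.
rewrite /left_act (@fsum_single _ _ _ _ _ mone) //.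
  by rewrite -/(left_term _ _) fpsZE left_term1.
move=> a _ a1; rewrite fpsZE -/(left_term _ _).
have [->|/eqP nz] := eqVneq (ham n a) 0; first by rewrite mul0r.
have [fa xa] := ham_supp char0 nz.
have [k ak] : exists k, a (vp k) <> 0%N.
  apply: contrapT => /forallNP a0; move/negP: a1; apply; apply/eqP.
  by apply: face_pq_noP => // k; apply: contrapT; apply: a0.
rewrite (@left_term_eq0 _ _ _ k) ?mulr0 // (faceP _ _ fm) //.
by rewrite lt0n; apply/eqP.
Qed.

Lemma lin_part_left_act n f : hb != 0 ->
  lin_part p1 (left_act (ham n) f) = (ham n mone + Zcoef hb n) *: lin_part p1 f.
Proof.
move=> hb0; apply/funext => m; rewrite fpsZE !lin_partE //.
case: ifP => [fm|]; last by rewrite mulr0.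
have mp k : m (vp k) = 0%N by apply: (faceP _ _ fm).
have ne : p1q1 != mone by apply/eqP => /(congr1 (fun a : mono => a (vp 1))); rewrite cmM cmUU cm1.
rewrite /left_act (@fsumE _ _ _ _ _ [:: mone; p1q1]) //.
- rewrite big_cons big_seq1 !fpsZE -!/(left_term _ _) left_term1 (left_term_p1q1 _ (mp 1%N)).
  by rewrite ham_p1q1 // mulrDl mulrA (mulrC _ hb) mulVKf.
- by rewrite cons_uniq mem_seq1 eq_sym ne.
move=> a _; rewrite !inE negb_or => /andP[a1 apq]; rewrite fpsZE -/(left_term _ _).
have [->|/eqP nz] := eqVneq (ham n a) 0; first by rewrite mul0r.
have [fa xa] := ham_supp char0 nz.
have [k lt] : exists k, (mmul (ucm p1) m (vp k) < a (vp k))%N.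
  apply: contrapT => /forallNP le.
  have {}le k : (a (vp k) <= (vp 1 == vp k))%N.
    by rewrite leqNgt; apply/negP => lt; apply: (le k); rewrite cmM cmU mp addn0.
  have a0 k : k != 1%N -> a (vp k) = 0%N.
    move=> k1; apply/eqP; rewrite -leqn0; apply: leq_trans (le k) _.
    by case: eqP => // -[e]; rewrite e eqxx in k1.
  have [ap|ap] := eqVneq (a (vp 1)) 0%N.
    move/eqP: a1; apply; apply: face_pq_noP => // k.
    by have [->|/a0] := eqVneq k 1%N.
  move/eqP: apq; apply; apply: face_pq_P1 => //.
  by apply/eqP; rewrite eqn_leq lt0n ap andbT; apply: leq_trans (le 1%N) _; rewrite eqxx.
by rewrite (@left_term_eq0 _ _ _ k) ?mulr0.
Qed.

Definition slin (c : nat -> K) : fps K := fsum setT (fun n : nat => c n *: fvar K (vs n)).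

Lemma slin_mone c : slin c mone = 0.
Proof. by apply: fsum_eq0 => n _; rewrite fpsZE fmonE eq_sym cm1_eq1 mulr0. Qed.

Lemma summable_slin c : summable setT (fun n : nat => c n *: fvar K (vs n)).
Proof.
move=> m; apply: (@sub_finite_set _ _ [set n | m (vs n) != 0%N]%classic).
  move=> n [_ /=]; rewrite fpsZE fmonE; case: eqP => [->|]; last by rewrite mulr0.
  by rewrite cmUU.
apply: (@sub_finite_set _ _ ((fun v => if v is vs n then n else 0%N) @`
  [set` (finsupp m : seq var)])%classic); last exact/finite_image/finite_seq.
by move=> n /=; rewrite cmE_neq0 => mn; exists (vs n).
Qed.

Lemma slinD c d : slin (fun n => c n + d n) = slin c + slin d.
Proof.
rewrite /slin fsumD; [|exact: summable_slin|exact: summable_slin].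
by apply: eq_fsum => n _; rewrite scalerDl.
Qed.

Lemma slin_trunc c m : exists N0, forall N, (N0 <= N)%N ->
  eq_below m (slin c) (\sum_(n <- iota 0 N) c n *: fvar K (vs n)).
Proof.
pose ix v := if v is vs n then n else 0%N.
exists (\sum_(v <- finsupp m) (ix v).+1)%N => N leN a b e.
rewrite /slin (@fsum_nat _ _ _ N) => [|n Nn].
  by rewrite -(big_mkord xpredT (fun n => c n *: fvar K (vs n))) /index_iota subn0.
rewrite fpsZE fmonE; case: eqP => [ea|]; last by rewrite mulr0.
have nm : vs n \in finsupp m by rewrite -cmE_neq0 -e cmM ea cmUU.
have := leq_trans leN Nn; by rewrite (big_fsetD1 (vs n)) //= addSn ltnNge leq_addr.
Qed.

Definition cap_step n f : fps K := opexp (fun g => fvar K (vs n) * left_act (ham n) g) f.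

Lemma smul_mone c n : (c *: fvar K (vs n)) mone = 0 :> K.
Proof. by rewrite fpsZE fmonE eq_sym cm1_eq1 mulr0. Qed.

Lemma foldr_cap_step (L : {linear fps K -> fps K}) (c : nat -> K) (r : seq nat) f :
  cont L ->
  (forall n g, L (fvar K (vs n) * g) = fvar K (vs n) * L g) ->
  (forall n g, L (left_act (ham n) g) = c n *: L g) ->
  L (foldr cap_step f r) = fexp (\sum_(n <- r) c n *: fvar K (vs n)) * L f.
Proof.
move=> cL Ls Lh; elim: r => [|n r IH] /=; first by rewrite big_nil fexp0 mul1r.
rewrite big_cons fexpD ?smul_mone //; last first.
  by rewrite fps_sumE big1 // => i _; rewrite smul_mone.
rewrite -mulrA -IH /cap_step (@opexp_eigen _ _ _ (c n *: fvar K (vs n))) ?smul_mone //.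
by move=> g; rewrite Ls Lh -scalerAl scalerAr.
Qed.

Lemma proj_fvarM n g : proj s_var (fvar K (vs n) * g) = fvar K (vs n) * proj s_var g.
Proof. by rewrite rmorphM /= proj_fvar. Qed.

Lemma lin_part_fvarM n g :
  lin_part p1 (fvar K (vs n) * g) = fvar K (vs n) * lin_part p1 g.
Proof. by rewrite lin_partM lin_part_fvar mul0r add0r proj_fvar. Qed.

Lemma proj_cap_limit f h :
  (forall m, exists N0, forall N, (N0 <= N)%N -> foldr cap_step f (iota 0 N) m = h m) ->
  proj s_var h = fexp (slin (fun n => ham n mone)) * proj s_var f.
Proof.
move=> lim; apply/funext => m.
have [N1 e1] := lim m; have [N2 e2] := slin_trunc (fun n => ham n mone) m.
pose N := maxn N1 N2.
transitivity (proj s_var (foldr cap_step f (iota 0 N)) m).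
  by rewrite /proj e1 ?leq_maxl.
rewrite (foldr_cap_step (L := proj s_var) (c := fun n => ham n mone)).
- apply: eq_fpsM => a b e; congr (_ * _); apply: eq_below_fexp => c d e'.
  apply/esym/(e2 N (leq_maxr _ _) c (mmul d b)); by rewrite mulmA e'.
- by move=> G /=; rewrite proj_fsum.
- exact: proj_fvarM.
- exact: proj_left_act.
Qed.

Lemma lin_cap_limit f h : hb != 0 ->
  (forall m, exists N0, forall N, (N0 <= N)%N -> foldr cap_step f (iota 0 N) m = h m) ->
  lin_part p1 h = fexp (slin (fun n => ham n mone + Zcoef hb n)) * lin_part p1 f.
Proof.
move=> hb0 lim; apply/funext => m; pose c n := ham n mone + Zcoef hb n.
have [N1 e1] := lim (mmul (ucm p1) m); have [N2 e2] := slin_trunc c m.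
pose N := maxn N1 N2.
transitivity (lin_part p1 (foldr cap_step f (iota 0 N)) m).
  by rewrite !lin_partE // e1 ?leq_maxl.
rewrite (foldr_cap_step (L := lin_part p1) (c := c)).
- apply: eq_fpsM => a b e; congr (_ * _); apply: eq_below_fexp => x y e'.
  by apply/esym/(e2 N (leq_maxr _ _) x (mmul y b)); rewrite mulmA e'.
- by move=> G /=; rewrite lin_part_fsum.
- exact: lin_part_fvarM.
- by move=> n g; exact: lin_part_left_act.
Qed.

Lemma lin_part_cap F : hb != 0 -> at_s0 F = hb^-1 *: fvar K p1 ->
  (forall m, exists N0, forall N, (N0 <= N)%N ->
    foldr cap_step (fexp (at_s0 F)) (iota 0 N) m = fexp F m) ->
  F mone = 0 /\ lin_part p1 F = hb^-1 *: fexp (slin (Zcoef hb)).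
Proof.
move=> hb0 F0 lim.
have Z0 : (hb^-1 *: fvar K p1) mone = 0 by rewrite fpsZE fmonE eq_sym cm1_eq1 mulr0.
have F1 : F mone = 0.
  by have := congr1 (fun f : fps K => f mone) F0; rewrite /= at_s0E projE ?face1 // Z0.
have P0 : proj s_var (hb^-1 *: fvar K p1) = 0 by rewrite linearZ /= proj_fvar scaler0.
split=> //; have := lin_cap_limit hb0 lim; rewrite slinD fexpD ?slin_mone //.
have := proj_cap_limit lim.
rewrite proj_fexp F0 proj_fexp P0 fexp0 mulr1 => eF.
rewrite !lin_part_fexp // P0 fexp0 mul1r eF linearZ /= lin_part_fvar eqxx -mulrA.
by move/(fexp_lreg char0 (slin_mone _)) => ->; rewrite mulr1n -scalerAr mulr1.
Qed.

Definition p_index v := if v is vp k then k else 0%N.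
Definition p_weight m := (\sum_(v <- finsupp m) p_index v * m v)%N.

Lemma p_weightEw m (d : {fset var}) : {subset finsupp m <= d} ->
  p_weight m = (\sum_(v <- d) p_index v * m v)%N.
Proof.
move=> /fsubsetP sub; rewrite /p_weight (big_fset_incl _ sub) // => v _.
by rewrite -cmE_eq0 => /eqP->; rewrite muln0.
Qed.

Lemma p_weightM a b : p_weight (mmul a b) = (p_weight a + p_weight b)%N.
Proof.
rewrite (@p_weightEw a (finsupp (mmul a b))); last by move=> v; rewrite mdomD inE => ->.
rewrite (@p_weightEw b (finsupp (mmul a b))); last by move=> v; rewrite mdomD inE orbC => ->.
by rewrite -big_split; apply: eq_bigr => v _ /=; rewrite -mulnDr cmM.
Qed.

Lemma p_weightU v : p_weight (ucm v) = p_index v.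
Proof. by rewrite /p_weight mdomU big_seq_fset1 cmUU muln1. Qed.

Definition cap_var v := match v with vs _ => true | vp k => (0 < k)%N | _ => false end.

Lemma p_weight_eq0 m : face cap_var m -> (p_weight m == 0%N) = face s_var m.
Proof.
move=> /faceP fm; apply/idP/idP => [w0|/allP fs]; last first.
  by rewrite /p_weight big1_seq // => v /andP[_ /fs]; case: v.
apply/allP => v vm; have : cap_var v.
  by move: vm; rewrite -cmE_neq0; apply: contraR => /fm->.
case: v vm => // k; rewrite -cmE_neq0 => mk /= k0; move: w0.
by rewrite -(mmul_ucm mk) p_weightM p_weightU addn_eq0 /= -leqn0 leqNgt k0.
Qed.

Lemma p_weight_neq1 m : face cap_var m -> m p1 = 0%N -> p_weight m != 1%N.
Proof.
move=> fm mp; apply/eqP => w1.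
have : ~~ face s_var m by rewrite -p_weight_eq0 // w1.
case/allPn => v vm; have : cap_var v by move/allP: fm; apply.
case: v vm => // k; rewrite -cmE_neq0 => mk /= k0 _; move: w1.
rewrite -(mmul_ucm mk) p_weightM p_weightU /=.
have k1 : k != 1%N by apply: contraNneq mk => ->; rewrite mp.
by lia.
Qed.

Lemma pdegree_prod m :
  \prod_(v <- finsupp m) (if v is vp k then fX K vz ^+ k * fX K v else fX K v) ^+ m v =
  fmon K (mmul m (mpow (p_weight m) (ucm vz))).
Proof.
have -> : fX K = (fun v => fvar K v) by apply/funext => v; exact: fXE.
rewrite fmon_mul -fmonX -(prod_fvar _ m) /p_weight expr_sum -big_split; apply: eq_bigr => v _ /=.
by case: v => [n|k|k|]; rewrite /= ?mul0n ?expr0 ?mulr1 // exprMn -exprM mulrC.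
Qed.

Lemma pdegree_part1 F : proj cap_var F = F ->
  pdegree_part 1 F = fvar K p1 * lin_part p1 F.
Proof.
move=> supF; apply/funext => m; rewrite /pdegree_part (coefzE char0).
have -> : (fvar K p1 * lin_part p1 F) m = if p_weight m == 1%N then F m else 0.
  have [Fm|/eqP Fm] := eqVneq (F m) 0.
    rewrite Fm if_same; have [mp|mp] := eqVneq (m p1) 0%N.
      by rewrite fmonM0 //; exists p1; rewrite mp cmUU.
    by rewrite -(mmul_ucm mp) fmonM lin_partE // mmul_ucm // Fm if_same.
  have fm := proj_id_face supF Fm.
  have [mp|mp] := eqVneq (m p1) 0%N.
    rewrite fmonM0; last by exists p1; rewrite mp cmUU.
    by rewrite (negPf (p_weight_neq1 fm mp)).
  have := mmul_ucm mp; set b := divcm _ _ => em.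
  have fb : face cap_var b by move: fm; rewrite -em faceM => /andP[].
  have -> : p_weight m = (1 + p_weight b)%N by rewrite -em p_weightM p_weightU.
  rewrite -[in LHS]em fmonM lin_partE // em -p_weight_eq0 //.
case: eqP => [mz|mz]; last first.
  case: eqP => // _; apply: contrapT => /nesym Fm; apply: mz.
  by apply: (faceP _ _ (proj_id_face supF Fm)).
rewrite /fsubst (@fsum_single _ _ _ _ _ m) // => [|a _ am].
  rewrite fpsZE pdegree_prod fmonE /= mulm1 mulmC.
  have -> : (mmul m (ucm vz) == mmul m (mpow (p_weight m) (ucm vz))) = (p_weight m == 1%N).
    apply/eqP/eqP => [/mmulI/(congr1 (fun m : mono => m vz))|->]; last by rewrite /= mulm1.
    by rewrite mpowE cmUU muln1.
  by case: eqP => _; rewrite ?mulr1 ?mulr0.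
rewrite fpsZE pdegree_prod fmonE.
have [Fa|/eqP Fa] := eqVneq (F a) 0; first by rewrite Fa mul0r.
case: eqP => [e|]; last by rewrite mulr0.
have az : a vz = 0%N by apply: (faceP _ _ (proj_id_face supF Fa)).
move/negP: am; case; apply/eqP/monoP => v.
have [->|vz'] := eqVneq v vz; first by rewrite az mz.
move/(congr1 (fun m : mono => m v)): e.
by rewrite cmM [RHS]cmM !mpowE !cmU eq_sym (negPf vz') !muln0 addn0 add0n.
Qed.

End DegreeOneCap.

(** * The projective line in degree one *)

Section DegreeOneP1.
Variables (K : fieldType) (hb : K).
Hypothesis char0 : [pchar K] =i pred0.
Implicit Types (f g h F : fps K) (m a b : mono) (A : pred var).
Local Notation X := (fun v => fvar K v).
Local Notation z := (fvar K vz).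
Local Notation right_act := (right_act hb X).
Let p1 := vp 1.
Let q1 := vq 1.

Definition right_term a f : fps K :=
  opmono (fun v => if v is vp k then fun g => (hb * k%:R) *: (z ^+ k * fderiv (vq k) g)
                   else *%R (fvar K v)) a f.

Let c v : fps K := if v is vp k then (hb * k%:R) *: 1 else fvar K v.
Let D v : fps K -> fps K := if v is vp k then fderiv (vq k) else id.

Lemma right_termE a f : face cap_var a ->
  right_term a f = z ^+ p_weight a * (\prod_(v <- finsupp a) c v ^+ a v * opmono D a f).
Proof.
move=> /allP fa.
rewrite /right_term (@opmono_mul _ _ D (fun v => z ^+ p_index v * c v)); first last.
- move=> v w g /fa cv /fa cw; case: v cv => // k _; rewrite /D fderivM.
  rewrite [X in X * g + _](_ : _ = 0) ?mul0r ?add0r // fderivM fderivX fderiv_fvar.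
  rewrite mulr0 scaler0 mul0r add0r; case: w cw => // [n|j] _; rewrite /c.
    by rewrite fderiv_fvar mulr0.
  by rewrite linearZ /= -(expr0 (1 : fps K)) fderivX scale0r scaler0 mulr0.
- move=> [n|k|k|] g _; rewrite /c /D ?mul1r //=.
  by rewrite -scalerAr mulr1 -scalerAl.
rewrite mulrA; congr (_ * _); rewrite /p_weight expr_sum -big_split.
by apply: eq_bigr => v _; rewrite /= exprMn -exprM.
Qed.

Lemma right_term_s a f : face s_var a -> right_term a f = fmon K a * f.
Proof.
move=> sa; have ca : face cap_var a by move: sa; apply: sub_all => -[].
have := sa; rewrite -p_weight_eq0 // => /eqP w0.
rewrite right_termE // w0 expr0 mul1r -prod_fvar; move/allP: sa => sa.
rewrite (@opmono_single _ D vz) => [|v g /sa]; last by case: v.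
rewrite (_ : iter _ _ f = f); last by elim: (a vz).
congr (_ * _); apply: eq_big_seq => v /sa.
by case: v.
Qed.

Lemma right_term_p1 b f : face s_var b ->
  right_term (mmul (ucm p1) b) f = fmon K b * (hb *: (z * fderiv q1 f)).
Proof.
move=> sb; set a := mmul _ _.
have cb : face cap_var b by move: sb; apply: sub_all => -[].
have ca : face cap_var a by rewrite faceM faceU.
have := sb; rewrite -p_weight_eq0 // => /eqP w0.
have bp : b p1 = 0%N by apply: (faceP _ _ sb).
have ap : a p1 = 1%N by rewrite cmM cmUU bp.
rewrite right_termE // p_weightM w0 p_weightU /= expr1.
rewrite (@opmono_single _ D p1) => [|v g]; last first.
  by rewrite mdomD mdomU !inE => /orP[->//|/(allP sb)]; case: v.
rewrite ap prod_finsuppM mdomU big_seq_fset1 cmUU expr1 /=.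
have -> : \prod_(v <- finsupp b) c v ^+ b v = fmon K b.
  by rewrite -prod_fvar; apply: eq_big_seq => v /(allP sb); case: v.
rewrite /c /D mulr1 -!scalerAl mul1r -!scalerAr; congr (_ *: _).
by rewrite mulrCA.
Qed.

Lemma right_term_low a f m : face cap_var a -> (m vz < p_weight a)%N ->
  right_term a f m = 0.
Proof.
move=> ca lt; rewrite right_termE // fmonX fmonM0 //; exists vz.
by rewrite mpowE cmUU muln1.
Qed.

Lemma right_act0 F f m : proj cap_var F = F -> m vz = 0%N ->
  right_act F f m = (proj s_var F * f) m.
Proof.
move=> supF mz; rewrite -[proj s_var F]fsum_fmon fsumM; last exact: summable_fmon.
apply: eq_fsum_at => a _; rewrite fpsZE -/(right_term a f) -scalerAl fpsZE.
have [Fa|/eqP Fa] := eqVneq (F a) 0; first by rewrite /proj Fa if_same !mul0r.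
have ca := proj_id_face supF Fa.
case: (boolP (face s_var a)) => sa; first by rewrite projE // right_term_s.
rewrite /proj (negPf sa) mul0r right_term_low ?mulr0 // mz lt0n.
by rewrite p_weight_eq0.
Qed.

Lemma right_act1 F f m : proj cap_var F = F -> m vz = 1%N ->
  right_act F f m =
    (proj s_var F * f + lin_part p1 F * (hb *: (z * fderiv q1 f))) m.
Proof.
move=> supF mz; set Y := hb *: _.
pose t1 a := (proj s_var F a *: fmon K a) * f.
pose t2 a := if a p1 == 0%N then 0 else
  (lin_part p1 F (divcm a (ucm p1)) *: fmon K (divcm a (ucm p1))) * Y.
have divK b : divcm (mmul (ucm p1) b) (ucm p1) = b.
  by apply: monoP => v; rewrite divcmE cmM addKn.
have t2E b : t2 (mmul (ucm p1) b) = (lin_part p1 F b *: fmon K b) * Y.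
  by rewrite /t2 cmM cmUU /= divK.
have s1 : summable setT t1 by apply: summableM; exact: summable_fmon.
have s2 : summable setT t2.
  move=> n; apply: (@sub_finite_set _ _ ((mmul (ucm p1)) @`
      [set b | ((lin_part p1 F b *: fmon K b) * Y) n <> 0])%classic).
    move=> a [_ /=]; rewrite /t2; case: eqVneq => // ap nz.
    by exists (divcm a (ucm p1)) => //; rewrite mmul_ucm.
  apply: finite_image; have := @summableM _ _ _ _ Y (summable_fmon (lin_part p1 F)).
  by move/(_ n); rewrite setTI.
transitivity ((fsum setT t1 + fsum setT t2) m); last first.
  rewrite !fpsDE /t1 -fsumM; last exact: summable_fmon.
  rewrite fsum_fmon; congr (_ + _).
  rewrite -[lin_part p1 F]fsum_fmon fsumM; last exact: summable_fmon.
  rewrite (@fsum_reindex _ _ _ (mmul (ucm p1))).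
  - by apply: eq_fsum_at => b _; rewrite t2E.
  - by move=> a b; exact: mmulI.
  - move=> a na; rewrite /t2; case: eqVneq => // ap.
    by case: (na (divcm a (ucm p1))); rewrite mmul_ucm.
rewrite fsumD //; apply: eq_fsum_at => a _; rewrite fpsZE -/(right_term a f) fpsDE.
rewrite /t1 -scalerAl fpsZE.
have t2Z : t2 a m = if a p1 == 0%N then 0 else
    lin_part p1 F (divcm a (ucm p1)) * (fmon K (divcm a (ucm p1)) * Y) m.
  by rewrite /t2; case: ifP => // _; rewrite -scalerAl.
rewrite t2Z; have [Fa|/eqP Fa] := eqVneq (F a) 0.
  rewrite {1}/proj Fa if_same !mul0r add0r; case: eqVneq => // ap.
  by rewrite lin_partE // mmul_ucm // Fa if_same mul0r.
have ca := proj_id_face supF Fa.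
case: (boolP (face s_var a)) => sa.
  by rewrite projE // right_term_s // (faceP _ _ sa) // eqxx addr0.
rewrite {1}/proj (negPf sa) mul0r add0r; case: eqVneq => [ap|ap].
  rewrite right_term_low ?mulr0 // mz ltn_neqAle eq_sym p_weight_neq1 //=.
  by rewrite lt0n p_weight_eq0.
have := mmul_ucm ap; set b := divcm _ _ => ea.
have cb : face cap_var b by move: ca; rewrite -ea faceM => /andP[].
rewrite lin_partE // ea; case: ifP => sb.
  by rewrite -{2}ea right_term_p1.
rewrite mul0r right_term_low ?mulr0 // mz -ea p_weightM p_weightU /= add1n ltnS.
by rewrite lt0n p_weight_eq0 ?sb.
Qed.

End DegreeOneP1.

Section P1Degree.
Variables (K : fieldType) (hb : K).
Hypotheses (char0 : [pchar K] =i pred0) (hb0 : hb != 0).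
Implicit Types (f g h F : fps K) (m a b : mono).
Local Notation X := (fun v => fvar K v).
Local Notation z := (fvar K vz).
Local Notation right_act := (right_act hb X).
Let p1 := vp 1.
Let q1 := vq 1.

Lemma proj_s_id f : proj s_var (proj s_var f) = proj s_var f.
Proof. exact: proj_sub. Qed.

Lemma lin_part_proj v f : ~~ s_var v -> lin_part v (proj s_var f) = 0.
Proof. by move=> sv; rewrite /lin_part /= fderiv_proj0 // linear0. Qed.

Lemma lin_part_lin_part v w f : ~~ s_var v -> lin_part v (lin_part w f) = 0.
Proof. by move=> sv; rewrite {2}/lin_part lin_part_proj. Qed.

Section RightAction.
Variable F : fps K.
Hypothesis supF : proj cap_var F = F.
Let F0 := proj s_var F.
Let F1 := lin_part p1 F.

Lemma proj_right_act f : proj s_var (right_act F f) = F0 * proj s_var f.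
Proof.
rewrite -[F0]proj_s_id -rmorphM; apply/funext => m; rewrite /= /proj.
case: ifP => // fm; apply: right_act0 => //; exact: (faceP _ _ fm).
Qed.

Lemma lin_part_q_right_act f : lin_part q1 (right_act F f) = F0 * lin_part q1 f.
Proof.
rewrite -[F0]proj_s_id -[RHS]add0r -(mul0r (proj s_var f)).
rewrite -(@lin_part_proj q1 F) // -lin_partM; apply/funext => m.
rewrite !lin_partE //; case: ifP => // fm; apply: right_act0 => //.
by rewrite cmM cmU (faceP _ _ fm).
Qed.

Lemma lin_part_z_right_act f :
  lin_part vz (right_act F f) = F0 * lin_part vz f + F1 * (hb *: lin_part q1 f).
Proof.
transitivity (lin_part vz (F0 * f + F1 * (hb *: (z * fderiv q1 f)))).
  apply/funext => m; rewrite !lin_partE //; case: ifP => // fm.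
  by apply: right_act1 => //; rewrite cmM cmUU (faceP _ _ fm).
have zF0 : lin_part vz F0 = 0 by exact: lin_part_proj.
have zF1 : lin_part vz F1 = 0 by exact: lin_part_lin_part.
rewrite linearD /= !lin_partM zF0 zF1 !mul0r !add0r.
rewrite proj_s_id linearZ /= lin_partM lin_part_fvar eqxx mul1r proj_fvar mul0r addr0.
by rewrite [proj _ F1]proj_s_id.
Qed.

Lemma lin_part_z_opexp g : F mone = 0 -> lin_part vz g = 0 ->
  lin_part vz (opexp (right_act F) g) = fexp F0 * (F1 * (hb *: lin_part q1 g)).
Proof.
move=> Fm gz; have F00 : F0 mone = 0 by rewrite /F0 projE ?face1.
rewrite -(fexp_shift char0) // /opexp lin_part_fsum; apply: eq_fsum => k _.
rewrite linearZ /=; congr (_ *: _).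
have qk j : lin_part q1 (iter j (right_act F) g) = F0 ^+ j * lin_part q1 g.
  by elim: j => [|j IH]; rewrite ?mul1r // iterS lin_part_q_right_act IH exprS mulrA.
set W := F1 * _.
elim: k => [|k IH]; first by rewrite scale0r.
rewrite iterS lin_part_z_right_act IH qk.
have -> : F1 * (hb *: (F0 ^+ k * lin_part q1 g)) = F0 ^+ k * W.
  by rewrite /W -!scalerAr mulrCA.
case: k {IH} => [|k]; first by rewrite !scale0r mulr0 add0r scale1r.
by rewrite -scalerAr mulrA -exprS /= -[in RHS]natr1 scalerDl scale1r.
Qed.

End RightAction.

Definition P1_var v := match v with vs _ | vz => true | _ => false end.

Lemma coefz1_lin_part f : proj P1_var f = f -> coefz 1 f = lin_part vz f.
Proof.
move=> supf; apply/funext => m; rewrite (coefzE char0) lin_partE // /= mulm1.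
have [->|/eqP nz] := eqVneq (f (mmul (ucm vz) m)) 0; first by rewrite !if_same.
have := proj_id_face supf nz; rewrite faceM => /andP[_ /faceP fm].
congr (if _ then _ else _); apply/eqP/faceP => [mz|fs]; last exact: fs.
by move=> [n|k|k|] // _; apply: fm.
Qed.

Lemma lin_part_P1 F FP : proj cap_var F = F -> F mone = 0 ->
  fexp FP = at_q0 (opexp (right_act F) (fexp (hb^-1 *: fvar K q1))) ->
  lin_part vz FP = lin_part p1 F.
Proof.
move=> supF Fm eP; set g := fexp (_ *: _) in eP.
have Q0 : (hb^-1 *: fvar K q1) mone = 0 by rewrite fpsZE fmonE eq_sym cm1_eq1 mulr0.
have PQ : proj s_var (hb^-1 *: fvar K q1) = 0 by rewrite linearZ /= proj_fvar scaler0.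
have gs : proj s_var g = 1 by rewrite proj_fexp PQ fexp0.
have gl v : lin_part v g = (hb^-1 * (v == q1)%:R)%:A.
  by rewrite lin_part_fexp // PQ fexp0 mul1r linearZ /= lin_part_fvar -scalerA scaler_nat.
have F00 : proj s_var F mone = 0 by rewrite projE ?face1.
have nq v : s_var v -> (if v is vq _ then false else true) by case: v.
have e0 : proj s_var (fexp FP) = fexp (proj s_var F).
  rewrite eP at_q0E proj_sub // (@opexp_eigen _ _ _ (proj s_var F)) //.
  - by rewrite /= gs mulr1.
  - by move=> G /=; rewrite proj_fsum.
  - by move=> f; exact: proj_right_act.
have e1 : lin_part vz (fexp FP) = fexp (proj s_var F) * lin_part p1 F.
  rewrite eP at_q0E; transitivity (lin_part vz (opexp (right_act F) g)).
    by rewrite /lin_part /= fderiv_proj // proj_sub.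
  rewrite lin_part_z_opexp //; last by rewrite gl mulr0 scale0r.
  by rewrite gl eqxx mulr1 scalerA mulfV // scale1r mulr1.
(* Otherwise [fexp FP mone] would be the junk value 0. *)
have FPm : FP mone = 0.
  apply: contrapT => /eqP nz; have := congr1 (fun f : fps K => f mone) e0.
  rewrite /= projE ?face1 // (fexp_mone_eq0 char0) // fexp_mone //.
  by move/esym/eqP; rewrite oner_eq0.
move: e1; rewrite lin_part_fexp // -proj_fexp e0.
by move/(fexp_lreg char0 F00).
Qed.

Lemma slin_even :
  fsum setT (fun n : nat => (hb ^+ n / (2 ^ n.*2 * (n.*2.+1)`!)%:R) *: fvar K (vs n.*2)) =
  slin (Zcoef hb).
Proof.
apply/funext => m; rewrite /slin [RHS](@fsum_reindex _ _ _ double).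
- apply: eq_fsum_at => n _; rewrite !fpsZE; congr (_ * _).
  rewrite /Zcoef odd_double doubleK /S_coef.
  by rewrite -[(4 ^ n)%N]/((2 ^ 2) ^ n)%N -expnM mul2n mulrC.
- exact: double_inj.
- move=> j nj; rewrite /Zcoef; case: (boolP (odd j)) => oj; first by rewrite scale0r.
  by case: (nj j./2); rewrite -[RHS]odd_double_half (negPf oj).
Qed.
End P1Degree.

Lemma degree_one_potentials (K : fieldType) (hb : K) (X : var -> fps K)
    (c : nat -> seq nat -> seq nat -> K) (e : nat -> nat -> seq nat -> K)
    (Fcap := fsum [set i : nat * seq nat * seq nat | all (leq 1) i.2]%classic
      (fun '(g, ns, ks) =>
        c g ns ks *: (\prod_(n <- ns) X (vs n) * \prod_(k <- ks) (k%:R^-1 *: X (vp k)))))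
    (FP1 := fsum [set i : nat * nat * seq nat |
        let: (g, d, ns) := i in stable g d (size ns)]%classic
      (fun '(g, d, ns) => e g d ns *: (X vz ^+ d * \prod_(n <- ns) X (vs n))))
    (E := fsum setT (fun n : nat =>
       (hb ^+ n / (2 ^ n.*2 * (n.*2.+1)`!)%:R) *: X (vs n.*2))) :
  [pchar K] =i pred0 -> hb != 0 -> X = (fun v => fvar K v) ->
  at_s0 Fcap = hb^-1 *: X (vp 1) ->
  (forall m, exists N0, forall N, (N0 <= N)%N ->
    foldr (fun n => opexp (fun f => X (vs n) * left_act hb X (ham hb X n) f))
      (fexp (at_s0 Fcap)) (iota 0 N) m = fexp Fcap m) ->
  fexp FP1 = at_q0 (opexp (right_act hb X Fcap) (fexp (hb^-1 *: X (vq 1)))) ->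
  pdegree_part 1 Fcap = hb^-1 *: (fexp E * X (vp 1)) /\ coefz 1 FP1 = hb^-1 *: fexp E.
Proof.
move=> char0 hb0 XE; subst X => F_s0 F_exp P_exp.
have supF : proj cap_var Fcap = Fcap.
  rewrite proj_fsum; apply: eq_fsum => -[[g ns] ks] /= /allP ks1.
  rewrite linearZ /= rmorphM !rmorph_prod /=; congr (_ *: (_ * _)).
    by apply: eq_bigr => n _; rewrite proj_fvar.
  by apply: eq_big_seq => k /ks1 k1; rewrite linearZ /= proj_fvar /= k1.
have supP : proj P1_var FP1 = FP1.
  rewrite proj_fsum; apply: eq_fsum => -[[g d] ns] _.
  rewrite linearZ /= rmorphM rmorphXn rmorph_prod /= proj_fvar; congr (_ *: (_ * _)).
  by apply: eq_bigr => n _; rewrite proj_fvar.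
have [F1 lF] := lin_part_cap char0 hb0 F_s0 F_exp.
rewrite (pdegree_part1 char0 supF) (coefz1_lin_part char0 supP).
rewrite (lin_part_P1 char0 hb0 supF F1 P_exp) lF /E slin_even.
by rewrite -scalerAr mulrC.
Qed.

(** * The fraction field *)

Section Transfer.
Variable R : numFieldType.
Local Notation K := (Khbar R).
Local Notation hb := (hbar R).

Lemma i_ddx_freq_op : @i_ddx R = @freq_op K. Proof. by []. Qed.

Lemma xmean_circle_mean : @xmean R = @circle_mean K. Proof. by []. Qed.

Lemma S_hbar_z_series : S_hbar_z R = S_series hb (fX K). Proof. by []. Qed.

Lemma u_field_series : u_field R = u_series (fX K). Proof. by []. Qed.

Lemma S_ddx_freq : @S_ddx R = S_freq hb (fX K).
Proof. by apply/funext => f; rewrite /S_ddx i_ddx_freq_op. Qed.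

Lemma Hgen_series : Hgen R = ham_series hb (fX K).
Proof.
by rewrite /Hgen xmean_circle_mean S_hbar_z_series u_field_series S_ddx_freq.
Qed.

Lemma Hsym_ham : Hsym R = ham hb (fX K).
Proof. by apply/funext => n; rewrite /Hsym Hgen_series. Qed.

Lemma left_op_act : @left_op R = left_act hb (fX K).
Proof. by []. Qed.

Lemma right_op_act : @right_op R = right_act hb (fX K).
Proof. by []. Qed.
End Transfer.

Theorem theorem6p1 (R : numFieldType)
    (cap : nat -> seq nat -> seq nat -> R) (gw : nat -> nat -> seq nat -> R)
    (Fcap := cap_potential cap) (FP1 := P1_potential gw)
    (cap_s0 : at_s0 Fcap = (hbar R)^-1 *: p_ R 1)
    (cap_exp : op_prod_eq
       (fun n => opexp (fun f => s_ R n * left_op (Hsym R n) f))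
       (fexp (at_s0 Fcap)) (fexp Fcap))
    (P1_exp : fexp FP1 = at_q0 (opexp (right_op Fcap) (fexp ((hbar R)^-1 *: q_ R 1))))
    (E := fsum setT (fun n : nat =>
       (hbar R ^+ n / (2 ^ n.*2 * (n.*2.+1)`!)%:R) *: s_ R n.*2)) :
  pdegree_part 1 Fcap = (hbar R)^-1 *: (fexp E * p_ R 1) /\
  coefz 1 FP1 = (hbar R)^-1 *: fexp E.
Proof.
move: cap_exp P1_exp; rewrite Hsym_ham left_op_act right_op_act => cap_exp P1_exp.
have XE : fX (Khbar R) = (fun v => fvar (Khbar R) v) by apply/funext => v; exact: fXE.
exact (@degree_one_potentials (Khbar R) (hbar R) (fX (Khbar R))
  (fun g ns ks => hbar R ^+ g / hbar R * (((size ns)`! * (size ks)`!)%:R)^-1 *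
     Defs.cst (cap g ns ks))
  (fun g d ns => hbar R ^+ g / hbar R * ((size ns)`!%:R)^-1 * Defs.cst (gw g d ns))
  (Khbar_char0 R) (hbar_neq0 R) XE cap_s0 cap_exp P1_exp).
Qed.
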